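(* The $D$-modules $P_1(\Bbbk_{\chi^\ell})=P\otimes\Bbbk_{\chi^\ell}$, $0\le\ell\le3$, and $V_{i,j}$, $(i,j)\in\Lambda$, are the projective covers of the simple $D$-modules ($P_1(\Bbbk_{\chi^\ell})$ being the projective cover of $\Bbbk_{\chi^\ell}$, and $V_{i,j}$ being its own projective cover). In particular, as left $D$-modules, $${}_DD\simeq\bigoplus_{\ell=0}^{3}P_1(\Bbbk_{\chi^\ell})\ \oplus\bigoplus_{(i,j)\in\Lambda}V_{i,j}^{2}.$$
   Context: $\Bbbk$ is an algebraically closed field of characteristic zero, $\xi\in\Bbbk$ is a fixed primitive $4$-th root of unity and $\sqrt2$ a fixed square root of $2$. $\mathcal K$ is the $8$-dimensional Hopf algebra generated as an algebra by $a,b,c,d$ with relations $ab=\xi ba$, $ac=\xi ca$, $cb=bc=0$, $cd=\xi dc$, $bd=\xi db$, $ad=da$, $ad=1$, $b^2=c^2=0$, $a^2c=b$, $a^4=1$, and coproduct $\Delta(a)=a\otimes a+b\otimes c$, $\Delta(b)=a\otimes b+b\otimes d$, $\Delta(c)=c\otimes a+d\otimes c$, $\Delta(d)=c\otimes b+d\otimes d$. $D=D(\mathcal K^{\mathrm{cop}})$ is the Drinfeld double of $\mathcal K^{\mathrm{cop}}$; it has dimension $64$. As an algebra it is presented by generators $a,b,c,d,x,g$ subject to: the relations $ab=\xi ba$, $ac=\xi ca$, $cb=bc=0$, $cd=\xi dc$, $bd=\xi db$, $ad=da$, $ad=1$, $b^2=c^2=0$, $a^2c=b$, $a^4=1$ of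 $\mathcal K$ for $a,b,c,d$; $g^4=1$, $x^2=g^2-1$, $gx=-xg$; and $ag=ga$, $bg=-gb$, $cg=-gc$, $dg=gd$, $ax+\xi xa=\sqrt2\xi(b+gc)$, $bx-\xi xb=\sqrt2\xi(a-gd)$, $cx+\xi xc=\sqrt2\xi(d-ga)$, $dx-\xi xd=\sqrt2\xi(c+gb)$. Its comultiplication (used for tensor products of modules) is $\Delta(a)=a\otimes a+c\otimes b$, $\Delta(b)=b\otimes a+d\otimes b$, $\Delta(c)=a\otimes c+c\otimes d$, $\Delta(d)=b\otimes c+d\otimes d$, $\Delta(g)=g\otimes g$, $\Delta(x)=x\otimes1+g\otimes x$. The simple left $D$-modules are, up to isomorphism, the following. For $0\le j\le3$, $\Bbbk_{\chi^j}$ is the $1$-dimensional module given by the character $\chi^j(a)=\xi^j$, $\chi^j(b)=\chi^j(c)=\chi^j(x)=0$, $\chi^j(d)=\xi^{-j}$, $\chi^j(g)=(-1)^j$. With $\Lambda=\{(i,j)\in\mathbb Z_4\times\mathbb Z_4:2i\ne j\}$, for $(i,j)\in\Lambda$, $V_{i,j}$ is the $2$-dimensional module on which, in a fixed basis, $a\mapsto\begin{pmatrix}\xi^i&0\\0&\xi^{i+3}\end{pmatrix}$, $b\mapsto\begin{pmatrix}0&(-1)^i\\0&0\end{pmatrix}$, $c\mapsto\begin{pmatrix}0&1\\0&0\end{pmatrix}$, $d\mapsto\begin{pmatrix}\xi^{-i}&0\\0&\xi^{-i+1}\end{pmatrix}$, $g\mapsto\begin{pmatrix}\xi^j&0\\0&\xi^{j+2}\end{pmatrix}$,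 $x\mapsto\begin{pmatrix}0&\frac{\sqrt2}{2}\xi(\xi^i+\xi^{3i+j})\\ \sqrt2\xi(\xi^{3i}-\xi^{i+j})&0\end{pmatrix}$. $P$ is the $4$-dimensional $D$-module with basis $p_1,p_2,p_3,p_4$ and action: $a$: $p_1\mapsto p_1$, $p_2\mapsto-\xi p_2$, $p_3\mapsto\xi p_3$, $p_4\mapsto p_4$; $b$: $p_1\mapsto p_3$, $p_2\mapsto\xi p_4$, $p_3\mapsto0$, $p_4\mapsto0$; $c$: $p_1\mapsto-p_3$, $p_2\mapsto\xi p_4$, $p_3\mapsto0$, $p_4\mapsto0$; $d$: $p_1\mapsto p_1$, $p_2\mapsto\xi p_2$, $p_3\mapsto-\xi p_3$, $p_4\mapsto p_4$; $x$: $p_1\mapsto p_2+\sqrt2p_3$, $p_2\mapsto-\sqrt2p_4$, $p_3\mapsto p_4$, $p_4\mapsto0$; $g$: $p_1\mapsto p_1$, $p_2\mapsto-p_2$, $p_3\mapsto-p_3$, $p_4\mapsto p_4$. *)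

(* Defs.v *)
From HB Require Import structures.
From mathcomp Require Import all_boot all_order all_algebra.
From mathcomp Require Import boolp.
From mathcomp Require Import finmap monalg mxtens.
From mathcomp Require Import ring.

Set Implicit Arguments.
Unset Strict Implicit.
Unset Printing Implicit Defensive.

Import GRing.Theory.
Local Open Scope ring_scope.
Local Open Scope quotient_scope.

Section Modules.
Variable R : pzRingType.
Implicit Types M N P S : lmodType R.

Definition surj (A B : Type) (f : A -> B) : Prop := forall y, exists x, f x = y.

Definition iso M N : Prop := exists f : {linear M -> N}, bijective f.

Definition simple S : Prop :=
  (exists v : S, v <> 0) /\
  forall U : {pred S}, submod_closed U ->
    (forall v, v \in U -> v = 0) \/ (forall v, v \in U).

Definition projective P : Prop :=
  forall M N (f : {linear M -> N}) (h : {linear P -> N}), surj f ->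
    exists g : {linear P -> M}, forall p, f (g p) = h p.

(* The kernel of f is a superfluous submodule of P: U + Ker f = P implies
   U = P for every submodule U of P. *)
Definition superfluous_kernel P S (f : {linear P -> S}) : Prop :=
  forall U : {pred P}, submod_closed U ->
    (forall p, exists2 u, u \in U & exists2 w, f w = 0 & p = u + w) ->
    forall p, p \in U.

Definition projective_cover P S : Prop :=
  projective P /\
  exists f : {linear P -> S}, surj f /\ superfluous_kernel f.

End Modules.

(* Finite direct sums are realized as (dependent) products. *)
Section DirectSum.
Variables (R : pzRingType) (I : finType) (M : I -> lmodType R).

Definition dsum := {dffun forall i, M i}.

HB.instance Definition _ := Choice.on dsum.

Implicit Types u v w : dsum.
Definition dsum_zero : dsum := [ffun i => 0 : M i].
Definition dsum_opp u : dsum := [ffun i => - u i : M i].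
Definition dsum_add u v : dsum := [ffun i => u i + v i : M i].
Definition dsum_scale (a : R) u : dsum := [ffun i => a *: u i : M i].

Fact dsum_addA : associative dsum_add.
Proof. by move=> u v w; apply/ffunP => i; rewrite !ffunE addrA. Qed.
Fact dsum_addC : commutative dsum_add.
Proof. by move=> u v; apply/ffunP => i; rewrite !ffunE addrC. Qed.
Fact dsum_add0 : left_id dsum_zero dsum_add.
Proof. by move=> u; apply/ffunP => i; rewrite !ffunE add0r. Qed.
Fact dsum_addN : left_inverse dsum_zero dsum_opp dsum_add.
Proof. by move=> u; apply/ffunP => i; rewrite !ffunE addNr. Qed.

HB.instance Definition _ := GRing.isZmodule.Build dsum
  dsum_addA dsum_addC dsum_add0 dsum_addN.

Fact dsum_scaleA a b u : dsum_scale a (dsum_scale b u) = dsum_scale (a * b) u.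
Proof. by apply/ffunP => i; rewrite !ffunE scalerA. Qed.
Fact dsum_scale1 : left_id 1 dsum_scale.
Proof. by move=> u; apply/ffunP => i; rewrite !ffunE scale1r. Qed.
Fact dsum_scaleDr : right_distributive dsum_scale +%R.
Proof. by move=> a u v; apply/ffunP => i; rewrite !ffunE scalerDr. Qed.
Fact dsum_scaleDl u : {morph dsum_scale^~ u : a b / a + b}.
Proof. by move=> a b; apply/ffunP => i; rewrite !ffunE scalerDl. Qed.

HB.instance Definition _ := GRing.Zmodule_isLmodule.Build R dsum
  dsum_scaleA dsum_scale1 dsum_scaleDr dsum_scaleDl.

End DirectSum.

(* The k-algebra with generators X and relations p.1 = p.2, p in E: the quotient
   of the free algebra on X by the two-sided ideal generated by the
   p.1 - p.2. *)
Section Presentation.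
Variables (k : fieldType) (X : choiceType).

Definition free_alg : Type := {malg k[{fmonom X}]}.
HB.instance Definition _ := GRing.Lalgebra.on free_alg.

Definition var (x : X) : free_alg := locked << fmu x >>.

Definition ideal_pred (E : seq (free_alg * free_alg)) : {pred free_alg} :=
  fun f => `[< exists2 t : seq (free_alg * (free_alg * free_alg) * free_alg),
      {in t, forall uev, uev.1.2 \in E}
    & f = \sum_(uev <- t) uev.1.1 * (uev.1.2.1 - uev.1.2.2) * uev.2 >].
Arguments ideal_pred : simpl never.

Section Quotient.
Variable E : seq (free_alg * free_alg).

Fact ideal_zmod_closed : zmod_closed (ideal_pred E).
Proof.
split=> [|f g /asboolP[t tE ->] /asboolP[t' tE' ->]]; apply/asboolP.
  by exists [::]; rewrite ?big_nil.
exists (t ++ [seq ((- v.1.1, v.1.2), v.2) | v <- t']).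
  move=> v; rewrite mem_cat => /orP[/tE //|/mapP[w /tE' wE ->]] //.
rewrite big_cat big_map /=; congr (_ + _); rewrite -sumrN.
by apply: eq_bigr => v _; rewrite !mulNr.
Qed.

HB.instance Definition _ :=
  GRing.isZmodClosed.Build free_alg (ideal_pred E) ideal_zmod_closed.

Fact idealMl f g : g \in ideal_pred E -> f * g \in ideal_pred E.
Proof.
move=> /asboolP[t tE ->]; apply/asboolP.
exists [seq ((f * v.1.1, v.1.2), v.2) | v <- t].
  by move=> v /mapP[w /tE wE ->].
by rewrite big_map mulr_sumr; apply: eq_bigr => v _; rewrite !mulrA.
Qed.

Fact idealMr f g : g \in ideal_pred E -> g * f \in ideal_pred E.
Proof.
move=> /asboolP[t tE ->]; apply/asboolP.
exists [seq (v.1, v.2 * f) | v <- t].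
  by move=> v /mapP[w /tE wE ->].
by rewrite big_map mulr_suml; apply: eq_bigr => v _; exact: esym (mulrA _ _ _).
Qed.

Definition presented : Type := {ideal_quot (ideal_pred E)}.
HB.instance Definition _ := GRing.Zmodule.on presented.

Definition pi_presented (f : free_alg) : presented :=
  \pi_({ideal_quot (ideal_pred E)}) f.
Definition repr_presented (a : presented) : free_alg :=
  repr (a : {ideal_quot (ideal_pred E)}).

Fact repr_presentedK : cancel repr_presented pi_presented.
Proof. exact: reprK. Qed.

Fact pi_presentedP f g :
  pi_presented f = pi_presented g <-> f - g \in ideal_pred E.
Proof.
by rewrite Quotient.idealrBE; split => [fg|/eqP//]; apply/eqP.
Qed.

Fact pi_presentedD f g : pi_presented (f + g) = pi_presented f + pi_presented g.
Proof. exact: raddfD. Qed.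

Definition presented_one : presented := pi_presented 1.
Definition presented_mul (a b : presented) : presented :=
  pi_presented (repr_presented a * repr_presented b).

Fact pi_presentedM f g :
  presented_mul (pi_presented f) (pi_presented g) = pi_presented (f * g).
Proof.
apply/pi_presentedP.
set f' := repr_presented _; set g' := repr_presented _.
have ff' : f' - f \in ideal_pred E by apply/pi_presentedP/repr_presentedK.
have gg' : g' - g \in ideal_pred E by apply/pi_presentedP/repr_presentedK.
have -> : f' * g' - f * g = f' * (g' - g) + (f' - f) * g.
  by rewrite mulrBr mulrBl addrA subrK.
by apply: rpredD; [apply: idealMl|apply: idealMr].
Qed.

Fact presented_mulA : associative presented_mul.
Proof.
move=> a b c; rewrite -[a]repr_presentedK -[b]repr_presentedK.
by rewrite -[c]repr_presentedK !pi_presentedM mulrA.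
Qed.
Fact presented_mul1 : left_id presented_one presented_mul.
Proof. by move=> a; rewrite -[a]repr_presentedK pi_presentedM mul1r. Qed.
Fact presented_1mul : right_id presented_one presented_mul.
Proof. by move=> a; rewrite -[a]repr_presentedK pi_presentedM mulr1. Qed.
Fact presented_mulDl : left_distributive presented_mul +%R.
Proof.
move=> a b c; rewrite -[a]repr_presentedK -[b]repr_presentedK.
by rewrite -[c]repr_presentedK -pi_presentedD !pi_presentedM mulrDl pi_presentedD.
Qed.
Fact presented_mulDr : right_distributive presented_mul +%R.
Proof.
move=> a b c; rewrite -[a]repr_presentedK -[b]repr_presentedK.
by rewrite -[c]repr_presentedK -pi_presentedD !pi_presentedM mulrDr pi_presentedD.
Qed.

HB.instance Definition _ := GRing.Zmodule_isPzRing.Build presented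
  presented_mulA presented_mul1 presented_1mul presented_mulDl presented_mulDr.

End Quotient.

Section Evaluation.
Variables (n : nat) (rho : X -> 'M[k]_n).

Definition evalmx (f : free_alg) : 'M[k]_n :=
  \sum_(w <- msupp f) f@_w *: \prod_(x <- (w : seq X)) rho x.

Fact evalmxEw (d : {fset {fmonom X}}) f : fsubset (msupp f) d ->
  evalmx f = \sum_(w <- d) f@_w *: \prod_(x <- (w : seq X)) rho x.
Proof.
move=> fd; apply: big_fset_incl => // w _ /mcoeff_outdom ->.
by rewrite scale0r.
Qed.

Fact evalmxD f g : evalmx (f + g) = evalmx f + evalmx g.
Proof.
rewrite (evalmxEw (msuppD_le f g)) (evalmxEw (fsubsetUl (msupp f) (msupp g))).
rewrite (evalmxEw (fsubsetUr (msupp f) (msupp g))) -big_split /=.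
by apply: eq_bigr => w _; rewrite mcoeffD scalerDl.
Qed.

Fact evalmxZ c f : evalmx (c *: f) = c *: evalmx f.
Proof.
rewrite (evalmxEw (msuppZ_le c f)) scaler_sumr.
by apply: eq_bigr => w _; rewrite mcoeffZ scalerA.
Qed.

Fact evalmx0 : evalmx 0 = 0.
Proof. by rewrite -(scale0r 0) evalmxZ scale0r. Qed.

Fact evalmxN f : evalmx (- f) = - evalmx f.
Proof. by rewrite -scaleN1r evalmxZ scaleN1r. Qed.

Fact evalmxB f g : evalmx (f - g) = evalmx f - evalmx g.
Proof. by rewrite evalmxD evalmxN. Qed.

Fact evalmx_sum (I : Type) (r : seq I) (F : I -> free_alg) :
  evalmx (\sum_(i <- r) F i) = \sum_(i <- r) evalmx (F i).
Proof. exact: (big_morph _ evalmxD evalmx0). Qed.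

Fact evalmxU c w : evalmx << c *g w >> = c *: \prod_(x <- (w : seq X)) rho x.
Proof. by rewrite (evalmxEw msuppU_le) big_seq_fset1 mcoeffUU. Qed.

Fact evalmx1 : evalmx 1 = 1%:M.
Proof. by rewrite evalmxU scale1r fm1 big_nil. Qed.

Fact evalmxM f g : evalmx (f * g) = evalmx f *m evalmx g.
Proof.
rewrite -[f * g]/(fgmul f g) /fgmul evalmx_sum mulmx_suml.
apply: eq_bigr => v _; rewrite evalmx_sum mulmx_sumr.
apply: eq_bigr => w _; rewrite evalmxU fmM big_cat /=.
by rewrite -scalemxAl -scalemxAr scalerA.
Qed.

Fact evalmxX2 f : evalmx (f ^+ 2) = evalmx f *m evalmx f.
Proof. by rewrite expr2 evalmxM. Qed.

Fact evalmxX4 f :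
  evalmx (f ^+ 4) = evalmx f *m evalmx f *m (evalmx f *m evalmx f).
Proof. by rewrite (exprD f 2 2) evalmxM evalmxX2. Qed.

Fact evalmx_var x : evalmx (var x) = rho x.
Proof. by rewrite /var -lock evalmxU scale1r fmuE /= big_seq1. Qed.

End Evaluation.

Section Representations.
Variable E : seq (free_alg * free_alg).

Record representation (n : nat) := Representation {
  rep_gen :> X -> 'M[k]_n;
  rep_rel : {in E, forall p, evalmx rep_gen p.1 = evalmx rep_gen p.2} }.

Fact evalmx_ideal n (rho : representation n) f :
  f \in ideal_pred E -> evalmx rho f = 0.
Proof.
move=> /asboolP[t tE ->]; rewrite evalmx_sum big1_seq // => v /= /tE vE.
by rewrite !evalmxM evalmxB (rep_rel rho vE) subrr mulmx0 mul0mx.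
Qed.

Definition repmx n (rho : representation n) (a : presented E) : 'M[k]_n :=
  evalmx rho (repr_presented a).

Fact repmx_pi n (rho : representation n) f :
  repmx rho (pi_presented E f) = evalmx rho f.
Proof.
apply/eqP; rewrite -subr_eq0 -evalmxB; apply/eqP/evalmx_ideal.
exact/pi_presentedP/repr_presentedK.
Qed.

(* The left module of column vectors on which each generator x acts as
   v |-> rho x *m v. *)
Definition repmod n (rho : representation n) : Type := 'cV[k]_n.
HB.instance Definition _ n (rho : representation n) :=
  GRing.Zmodule.on (repmod rho).

Section RepModule.
Variables (n : nat) (rho : representation n).

Definition repmod_scale (a : presented E) (v : repmod rho) : repmod rho :=
  repmx rho a *m v.

Fact repmod_scaleA a b v :
  repmod_scale a (repmod_scale b v) = repmod_scale (a * b) v.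
Proof. by rewrite /repmod_scale repmx_pi evalmxM mulmxA. Qed.
Fact repmod_scale1 : left_id 1 repmod_scale.
Proof. by move=> v; rewrite /repmod_scale repmx_pi evalmx1 mul1mx. Qed.
Fact repmod_scaleDr : right_distributive repmod_scale +%R.
Proof. by move=> a u v; rewrite /repmod_scale mulmxDr. Qed.
Fact repmod_scaleDl v : {morph repmod_scale^~ v : a b / a + b}.
Proof.
move=> a b; rewrite -[a]repr_presentedK -[b]repr_presentedK -pi_presentedD.
by rewrite /repmod_scale !repmx_pi evalmxD mulmxDl.
Qed.

HB.instance Definition _ := GRing.Zmodule_isLmodule.Build (presented E)
  (repmod rho) repmod_scaleA repmod_scale1 repmod_scaleDr repmod_scaleDl.
End RepModule.

End Representations.
End Presentation.

Inductive gen : predArgType := Ga | Gb | Gc | Gd | Gx | Gg.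

Definition gen_code (h : gen) : 'I_6 :=
  match h with
  | Ga => inord 0 | Gb => inord 1 | Gc => inord 2
  | Gd => inord 3 | Gx => inord 4 | Gg => inord 5
  end.
Definition gen_decode (i : 'I_6) : gen := nth Ga [:: Ga; Gb; Gc; Gd; Gx; Gg] i.
Fact gen_codeK : cancel gen_code gen_decode.
Proof. by case; rewrite /gen_decode /= inordK. Qed.

HB.instance Definition _ := Countable.copy gen (can_type gen_codeK).

Fact all_inP (T : eqType) (E : seq T) (P : T -> Prop) :
  foldr (fun p Q => P p /\ Q) True E <-> {in E, forall p, P p}.
Proof.
elim: E => [|p E IH] /=; first by split=> // _ p; rewrite in_nil.
split=> [[Pp /IH PE] q|PE]; first by rewrite inE => /predU1P[->|/PE].
split; first by apply: PE; rewrite mem_head.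
by apply/IH => q qE; apply: PE; rewrite inE qE orbT.
Qed.

Definition Lambda : Type := {ij : 'Z_4 * 'Z_4 | ij.1 *+ 2 != ij.2}.
HB.instance Definition _ := Finite.on Lambda.

Section Double.
Variables (k : fieldType) (xi sqrt2 : k).

(* Presentation of the Drinfeld double of K^cop, where K is the 8-dimensional
   Hopf algebra generated by a, b, c, d; sqrt2 stands for a square root of 2. *)
Definition D_relations : seq (free_alg k gen * free_alg k gen) :=
  let a := var k Ga in let b := var k Gb in let c := var k Gc in
  let d := var k Gd in let x := var k Gx in let g := var k Gg in
  [:: (a * b, xi *: (b * a)); (a * c, xi *: (c * a)); (c * b, 0); (b * c, 0);
      (c * d, xi *: (d * c)); (b * d, xi *: (d * b)); (a * d, d * a);
      (a * d, 1); (b ^+ 2, 0); (c ^+ 2, 0); (a ^+ 2 * c, b); (a ^+ 4, 1);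
      (g ^+ 4, 1); (x ^+ 2, g ^+ 2 - 1); (g * x, - (x * g));
      (a * g, g * a); (b * g, - (g * b)); (c * g, - (g * c)); (d * g, g * d);
      (a * x + xi *: (x * a), (sqrt2 * xi) *: (b + g * c));
      (b * x - xi *: (x * b), (sqrt2 * xi) *: (a - g * d));
      (c * x + xi *: (x * c), (sqrt2 * xi) *: (d - g * a));
      (d * x - xi *: (x * d), (sqrt2 * xi) *: (c + g * b))].

Definition D := presented D_relations.

Section MatrixRelations.
Variable n : nat.

Record D_matrix_relations (a b c d x g : 'M[k]_n) : Prop := {
  D_ab : a *m b = xi *: (b *m a);
  D_ac : a *m c = xi *: (c *m a);
  D_cb : c *m b = 0;
  D_bc : b *m c = 0;
  D_cd : c *m d = xi *: (d *m c);
  D_bd : b *m d = xi *: (d *m b);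
  D_da : a *m d = d *m a;
  D_ad : a *m d = 1%:M;
  D_b2 : b *m b = 0;
  D_c2 : c *m c = 0;
  D_a2c : a *m a *m c = b;
  D_a4 : a *m a *m (a *m a) = 1%:M;
  D_g4 : g *m g *m (g *m g) = 1%:M;
  D_x2 : x *m x = g *m g - 1%:M;
  D_gx : g *m x = - (x *m g);
  D_ag : a *m g = g *m a;
  D_bg : b *m g = - (g *m b);
  D_cg : c *m g = - (g *m c);
  D_dg : d *m g = g *m d;
  D_ax : a *m x + xi *: (x *m a) = (sqrt2 * xi) *: (b + g *m c);
  D_bx : b *m x - xi *: (x *m b) = (sqrt2 * xi) *: (a - g *m d);
  D_cx : c *m x + xi *: (x *m c) = (sqrt2 * xi) *: (d - g *m a);
  D_dx : d *m x - xi *: (x *m d) = (sqrt2 * xi) *: (c + g *m b) }.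

Ltac eval_proof r t :=
  lazymatch t with
  | ?u + ?v => let p := eval_proof r u in let q := eval_proof r v in
      constr:(etrans (evalmxD r u v) (f_equal2 (fun M N => M + N) p q))
  | - ?u => let p := eval_proof r u in
      constr:(etrans (evalmxN r u) (f_equal (fun M => - M) p))
  | ?u * ?v => let p := eval_proof r u in let q := eval_proof r v in
      constr:(etrans (evalmxM r u v) (f_equal2 (fun M N => M *m N) p q))
  | ?e *: ?u => let p := eval_proof r u in
      constr:(etrans (evalmxZ r e u) (f_equal (fun M => e *: M) p))
  | var _ ?h => constr:(evalmx_var r h)
  | ?u ^+ 2 => let p := eval_proof r u in constr:(etrans (evalmxX2 r u)
      (f_equal (fun M => M *m M) p))
  | ?u ^+ 4 => let p := eval_proof r u in constr:(etrans (evalmxX4 r u)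
      (f_equal (fun M => M *m M *m (M *m M)) p))
  | 1 => constr:(evalmx1 r)
  | 0 => constr:(evalmx0 r)
  end.

Fact D_matrixP (r : gen -> 'M[k]_n) :
  D_matrix_relations (r Ga) (r Gb) (r Gc) (r Gd) (r Gx) (r Gg) <->
  {in D_relations, forall p, evalmx r p.1 = evalmx r p.2}.
Proof.
rewrite -all_inP /D_relations.
cbv beta iota zeta delta [foldr fst snd].
split=> [[]|].
{ move=> *; repeat apply: conj; last by [].
  all: lazymatch goal with |- evalmx ?r ?u = evalmx ?r ?v =>
    let p := eval_proof r u in let q := eval_proof r v in
    refine (etrans p (etrans _ (esym q))); cbv beta; assumption end. }
case=> h1 [h2 [h3 [h4 [h5 [h6 [h7 [h8 [h9 [h10 [h11 [h12 [h13 [h14 [h15 [h16]]]]]]]]]]]]]]].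
case=> h17 [h18 [h19 [h20 [h21 [h22 [h23 _]]]]]].
repeat match goal with h : evalmx ?r ?u = evalmx ?r ?v |- _ =>
  let p := eval_proof r u in let q := eval_proof r v in
  move: (etrans (esym p) (etrans h q)) => {h} end.
move=> *; constructor; assumption.
Qed.
End MatrixRelations.

Section Tensor.
Hypothesis xi2 : xi ^+ 2 = -1.

(* The action on a tensor product given by
   Delta a = a (x) a + c (x) b,  Delta b = b (x) a + d (x) b,
   Delta c = a (x) c + c (x) d,  Delta d = b (x) c + d (x) d,
   Delta x = x (x) 1 + g (x) x,  Delta g = g (x) g. *)
Definition tens_gen m n (r : gen -> 'M[k]_m) (s : gen -> 'M[k]_n) (h : gen) :
    'M[k]_(m * n) :=
  match h with
  | Ga => r Ga *t s Ga + r Gc *t s Gb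
  | Gb => r Gb *t s Ga + r Gd *t s Gb
  | Gc => r Ga *t s Gc + r Gc *t s Gd
  | Gd => r Gb *t s Gc + r Gd *t s Gd
  | Gx => r Gx *t 1%:M + r Gg *t s Gx
  | Gg => r Gg *t s Gg
  end.

Fact xi_neq0 : xi != 0.
Proof. by apply/eqP => xi0; move/eqP: xi2; rewrite xi0 expr0n /= eq_sym oppr_eq0 oner_eq0. Qed.

Fact tensmx_rel m n (a b c d x g : 'M[k]_m) (a' b' c' d' x' g' : 'M[k]_n) :
  D_matrix_relations a b c d x g -> D_matrix_relations a' b' c' d' x' g' ->
  D_matrix_relations
    (a *t a' + c *t b') (b *t a' + d *t b') (a *t c' + c *t d')
    (b *t c' + d *t d') (x *t 1%:M + g *t x') (g *t g').
Proof.
have flip l (A B : 'M[k]_l) : A = xi *: B -> B = - xi *: A.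
  by move=> ->; rewrite scalerA mulNr -expr2 xi2 opprK scale1r.
have solve l (A B C : 'M[k]_l) : A + B = C -> A = C - B by move<-; rewrite addrK.
case=> ab ac cb bc cd bd da ad b2 c2 a2c a4 g4 x2 gx ag bg cg dg ax bx cx dx.
case=> ab' ac' cb' bc' cd' bd' da' ad' b2' c2' a2c' a4' g4' x2' gx' ag' bg' cg' dg'.
move=> ax' bx' cx' dx'.
move: (flip _ _ _ ab) (flip _ _ _ ac) (flip _ _ _ cd) (flip _ _ _ bd) => ba ca dc db.
move: (flip _ _ _ ab') (flip _ _ _ ac') (flip _ _ _ cd') (flip _ _ _ bd') => ba' ca' dc' db'.
move: (solve _ _ _ _ ax) (solve _ _ _ _ bx) (solve _ _ _ _ cx) (solve _ _ _ _ dx).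
rewrite !opprK => {}ax {}bx {}cx {}dx.
move: (solve _ _ _ _ ax') (solve _ _ _ _ bx') (solve _ _ _ _ cx') (solve _ _ _ _ dx').
rewrite !opprK => {}ax' {}bx' {}cx' {}dx'.
have dan : d *m a = 1%:M by rewrite -da.
have dan' : d' *m a' = 1%:M by rewrite -da'.
have entry l1 l2 (A B : 'M[k]_(l1 * l2)) :
  (forall i j i' j', A (mxtens_index (i, i')) (mxtens_index (j, j')) =
     B (mxtens_index (i, i')) (mxtens_index (j, j'))) -> A = B.
  move=> AB; apply/matrixP => i j.
  by case: (mxtens_indexP i) => i0 i1; case: (mxtens_indexP j) => j0 j1; apply: AB.
have mxD p q (A B : 'M[k]_(p, q)) i j : (A + B) i j = A i j + B i j by rewrite mxE.
have mxN p q (A : 'M[k]_(p, q)) i j : (- A) i j = - A i j by rewrite mxE.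
have mxZ p q e (A : 'M[k]_(p, q)) i j : (e *: A) i j = e * A i j by rewrite mxE.
have mx0 p q i j : (0 : 'M[k]_(p, q)) i j = 0 by rewrite mxE.
have one_tens : (1%:M : 'M[k]_(m * n)) = 1%:M *t 1%:M.
  apply: entry => i j i' j'; rewrite tensmxE !mxE (can_eq (@mxtens_indexK _ _)).
  by rewrite xpair_eqE -natrM mulnb.
have aad l (A B : 'M[k]_l) : A *m B = 1%:M -> A *m A *m B = A.
  by rewrite -mulmxA => ->; rewrite mulmx1.
have cube l (A B : 'M[k]_l) :
    A *m A *m (A *m A) = 1%:M -> B *m A = 1%:M -> A *m A *m A = B.
  by move=> A4 BA; rewrite -[RHS]mulmx1 -A4 !mulmxA BA mul1mx.
have ab3 l (A B C E : 'M[k]_l) : A *m A *m A = E -> A *m A *m C = B ->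
    C *m E = xi *: (E *m C) -> C *m E = xi *: (A *m B).
  by move=> A3 A2C ->; rewrite -A2C !mulmxA A3.
have ac3 l (A B C E : 'M[k]_l) : A *m A *m C = B -> A *m E = 1%:M ->
    C *m E = xi *: (E *m C) -> B *m E = xi *: (A *m C).
  move=> <- AE CE; rewrite -!mulmxA CE -!scalemxAr.
  by rewrite [A *m (E *m C)]mulmxA AE mul1mx.
have a3 := cube _ _ _ a4 dan; have a3' := cube _ _ _ a4' dan'.
have cda := ab3 _ _ _ _ _ a3 a2c cd; have cda' := ab3 _ _ _ _ _ a3' a2c' cd'.
have bda := ac3 _ _ _ _ _ a2c ad cd; have bda' := ac3 _ _ _ _ _ a2c' ad' cd'.
have aa2 : (a *t a' + c *t b') *m (a *t a' + c *t b') = (a *m a) *t (a' *m a').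
  rewrite ?mulmxDl ?mulmxDr ?tensmx_mul ca ba' c2.
  apply: entry => i j i' j'; rewrite ?(mxD, mxN, mxZ, mx0, tensmxE).
  by ring: xi2.
split; rewrite ?aa2 ?mulmxDl ?mulmxDr ?tensmx_mul ?mulmx1 ?mul1mx ?a4 ?a4' ?g4 ?g4' ?a3 ?a2c ?a2c' ?(aad _ _ _ ad') ?one_tens //.
all: rewrite ?(ba, ca, cb, bc, dc, db, ad, dan, b2, c2, x2, gx, ag, bg, cg, dg, ax, bx, cx, dx, cda, bda).
all: rewrite ?(ba', ca', cb', bc', dc', db', ad', dan', b2', c2', x2', gx', ag', bg', cg', dg', ax', bx', cx', dx', cda', bda').
all: apply: entry => i j i' j'; rewrite ?(mxD, mxN, mxZ, mx0, tensmxE).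
all: by ring: xi2.
Qed.

Fact tens_gen_rel m n (r : representation D_relations m)
    (s : representation D_relations n) :
  {in D_relations, forall p, evalmx (tens_gen r s) p.1 = evalmx (tens_gen r s) p.2}.
Proof.
apply/D_matrixP/tensmx_rel; apply/D_matrixP; exact: rep_rel.
Qed.

Definition tens m n (r : representation D_relations m)
  (s : representation D_relations n) := Representation (tens_gen_rel r s).
End Tensor.

Fact prim4_sqr : 4.-primitive_root xi -> xi ^+ 2 = -1.
Proof.
move=> prim; have /eqP := prim_expr_order prim.
rewrite (exprM xi 2 2) -subr_eq0 subr_sqr_1 mulf_eq0 => /orP[|].
  by rewrite subr_eq0 -(prim_order_dvd prim).
by rewrite addr_eq0 => /eqP.
Qed.

Section SimplesAndP.
Hypothesis prim_xi : 4.-primitive_root xi.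
Hypothesis sqrt2P : sqrt2 ^+ 2 = 2.

Let xi2 := prim4_sqr prim_xi.

Definition chi_gen (l : 'I_4) (h : gen) : 'M[k]_1 :=
  match h with
  | Ga => (xi ^+ l)%:M
  | Gb => 0
  | Gc => 0
  | Gd => (xi ^- l)%:M
  | Gx => 0
  | Gg => ((-1) ^+ l)%:M
  end.

Definition mx2 (p q r s : k) : 'M[k]_2 :=
  \matrix_(i, j) (if i == 0 then if j == 0 then p else q
                             else if j == 0 then r else s).

Definition V_gen (i j : 'Z_4) (h : gen) : 'M[k]_2 :=
  match h with
  | Ga => mx2 (xi ^+ i) 0 0 (xi ^+ (i + 3))
  | Gb => mx2 0 ((-1) ^+ i) 0 0
  | Gc => mx2 0 1 0 0
  | Gd => mx2 (xi ^- i) 0 0 (xi ^- i * xi)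
  | Gx => mx2 0 (sqrt2 / 2 * xi * (xi ^+ i + xi ^+ (3 * i + j)))
              (sqrt2 * xi * (xi ^+ (3 * i) - xi ^+ (i + j))) 0
  | Gg => mx2 (xi ^+ j) 0 0 (xi ^+ (j + 2))
  end.

(* The endomorphism mapping the basis vector p_i to the i-th vector of cs. *)
Definition mx_of_images (cs : seq 'cV[k]_4) : 'M[k]_4 :=
  \matrix_(i, j) (cs`_j) i 0.

Definition P_gen (h : gen) : 'M[k]_4 :=
  let p (i : 'I_4) : 'cV[k]_4 := delta_mx i 0 in
  let p1 := p (inord 0) in let p2 := p (inord 1) in
  let p3 := p (inord 2) in let p4 := p (inord 3) in
  mx_of_images match h with
  | Ga => [:: p1; - xi *: p2; xi *: p3; p4]
  | Gb => [:: p3; xi *: p4; 0; 0]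
  | Gc => [:: - p3; xi *: p4; 0; 0]
  | Gd => [:: p1; xi *: p2; - xi *: p3; p4]
  | Gx => [:: p2 + sqrt2 *: p3; - sqrt2 *: p4; p4; 0]
  | Gg => [:: p1; - p2; - p3; p4]
  end.

Fact mx2M p q r s p' q' r' s' :
  mx2 p q r s *m mx2 p' q' r' s' =
  mx2 (p * p' + q * r') (p * q' + q * s') (r * p' + s * r') (r * q' + s * s').
Proof.
apply/matrixP => i j; rewrite !mxE !big_ord_recl big_ord0 addr0 !mxE /=.
by case: i => [[|[|//]] ?]; case: j => [[|[|//]] ?].
Qed.
Fact mx2D p q r s p' q' r' s' :
  mx2 p q r s + mx2 p' q' r' s' = mx2 (p + p') (q + q') (r + r') (s + s').
Proof. by apply/matrixP => i j; rewrite !mxE; do 2?case: ifP. Qed.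
Fact mx2N p q r s : - mx2 p q r s = mx2 (- p) (- q) (- r) (- s).
Proof. by apply/matrixP => i j; rewrite !mxE; do 2?case: ifP. Qed.
Fact mx2Z e p q r s : e *: mx2 p q r s = mx2 (e * p) (e * q) (e * r) (e * s).
Proof. by apply/matrixP => i j; rewrite !mxE; do 2?case: ifP. Qed.
Fact mx2_0 : 0 = mx2 0 0 0 0.
Proof. by apply/matrixP => i j; rewrite !mxE; do 2?case: ifP. Qed.
Fact mx2_1 : 1%:M = mx2 1 0 0 1.
Proof.
by apply/matrixP => i j; rewrite !mxE; case: i => [[|[|//]] ?]; case: j => [[|[|//]] ?].
Qed.

Fact two_neq0 : 2 != 0 :> k.
Proof.
apply/eqP => two0; have : xi ^+ 2 == 1.
  by rewrite xi2 -subr_eq0 -opprD oppr_eq0; apply/eqP.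
by rewrite -(prim_order_dvd prim_xi).
Qed.

Fact xiV (n : nat) : xi ^- n = xi ^+ n ^+ 3.
Proof.
have xi0 : xi != 0 by exact: xi_neq0.
apply: (mulfI (expf_neq0 n xi0)); rewrite mulfV ?expf_neq0 //.
by rewrite -exprS -exprM mulnC exprM (prim_expr_order prim_xi) expr1n.
Qed.

Fact signxi (n : nat) : (-1) ^+ n = xi ^+ n ^+ 2.
Proof. by rewrite -xi2 -!exprM mulnC. Qed.

Fact xi4 (n : nat) : xi ^+ n ^+ 4 = 1.
Proof. by rewrite -exprM mulnC exprM (prim_expr_order prim_xi) expr1n. Qed.

Fact chi_rel l :
  {in D_relations, forall p, evalmx (chi_gen l) p.1 = evalmx (chi_gen l) p.2}.
Proof.
apply/D_matrixP; rewrite /= xiV signxi; move: (xi4 l) => u4.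
set u := xi ^+ l in u4 *.
split; apply/matrixP => i j; rewrite !ord1 !(mxE, big_ord1) /= ?mulr1n.
all: by ring: u4.
Qed.

Fact V_rel i j :
  {in D_relations, forall p, evalmx (V_gen i j) p.1 = evalmx (V_gen i j) p.2}.
Proof.
have e : xi ^+ (3 * i) = (xi ^+ i) ^+ 3 by rewrite mulnC exprM.
have two := two_neq0.
apply/D_matrixP; rewrite /= ![xi ^+ (_ + j)]exprD !e ![xi ^+ (_ + 3)]exprD ![xi ^+ (_ + 2)]exprD xiV signxi.
move: (xi4 i) (xi4 j) => u4 v4.
set u := xi ^+ i in u4 *; set v := xi ^+ j in v4 *.
split; rewrite ?mx2_0 ?mx2_1 !(mx2M, mx2D, mx2N, mx2Z); congr mx2.
all: by field: xi2 sqrt2P u4 v4.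
Qed.

Definition mx4 (f : nat -> nat -> k) : 'M[k]_4 := \matrix_(i, j) f i j.

Fact mx4M f f' : mx4 f *m mx4 f' = mx4 (fun i j =>
  f i 0%N * f' 0%N j + f i 1%N * f' 1%N j + f i 2%N * f' 2%N j + f i 3%N * f' 3%N j).
Proof.
by apply/matrixP => i j; rewrite !mxE !big_ord_recl big_ord0 addr0 !mxE !addrA.
Qed.
Fact mx4D f f' : mx4 f + mx4 f' = mx4 (fun i j => f i j + f' i j).
Proof. by apply/matrixP => i j; rewrite !mxE. Qed.
Fact mx4N f : - mx4 f = mx4 (fun i j => - f i j).
Proof. by apply/matrixP => i j; rewrite !mxE. Qed.
Fact mx4Z e f : e *: mx4 f = mx4 (fun i j => e * f i j).
Proof. by apply/matrixP => i j; rewrite !mxE. Qed.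
Fact mx4_0 : 0 = mx4 (fun _ _ => 0).
Proof. by apply/matrixP => i j; rewrite !mxE. Qed.
Fact mx4_1 : 1%:M = mx4 (fun i j => (i == j)%:R).
Proof. by apply/matrixP => i j; rewrite !mxE. Qed.
Fact eq_mx4 f f' :
  (forall i j, (i < 4)%N -> (j < 4)%N -> f i j = f' i j) -> mx4 f = mx4 f'.
Proof. by move=> ff'; apply/matrixP => i j; rewrite !mxE ff'. Qed.

Definition P_rows (h : gen) : seq (seq k) :=
  match h with
  | Ga => [:: [:: 1; 0; 0; 0]; [:: 0; - xi; 0; 0]; [:: 0; 0; xi; 0]; [:: 0; 0; 0; 1]]
  | Gb => [:: [::]; [::]; [:: 1; 0; 0; 0]; [:: 0; xi; 0; 0]]
  | Gc => [:: [::]; [::]; [:: -1; 0; 0; 0]; [:: 0; xi; 0; 0]]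
  | Gd => [:: [:: 1; 0; 0; 0]; [:: 0; xi; 0; 0]; [:: 0; 0; - xi; 0]; [:: 0; 0; 0; 1]]
  | Gx => [:: [::]; [:: 1; 0; 0; 0]; [:: sqrt2; 0; 0; 0]; [:: 0; - sqrt2; 1; 0]]
  | Gg => [:: [:: 1; 0; 0; 0]; [:: 0; -1; 0; 0]; [:: 0; 0; -1; 0]; [:: 0; 0; 0; 1]]
  end.

Fact P_genE h : P_gen h = mx4 (fun i j => nth 0 (nth [::] (P_rows h) i) j).
Proof.
apply/matrixP => i j; rewrite /P_gen !mxE.
have ord4 m (lt_m : (m < 4)%N) n (lt_n : (n < 4)%N) :
  (Ordinal lt_m == inord n :> 'I_4) = (m == n) by rewrite -val_eqE /= inordK.
by case: h; case: j => [[|[|[|[|//]]]] ?] /=; rewrite !mxE;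
  case: i => [[|[|[|[|//]]]] ?]; rewrite ?ord4 //= ?eqxx ?andbT ?mulr1n ?mulr0n
    ?(mulr1, mulr0, addr0, add0r, oppr0).
Qed.

Fact P_rel : {in D_relations, forall p, evalmx P_gen p.1 = evalmx P_gen p.2}.
Proof.
apply/D_matrixP; rewrite !P_genE.
split; rewrite ?mx4_0 ?mx4_1 ?(mx4M, mx4D, mx4N, mx4Z); apply: eq_mx4.
all: by do 2![case=> [|[|[|[|//]]]]] => _ _ /=; ring: xi2 sqrt2P.
Qed.

Definition chi_rep l := Representation (chi_rel l).
Definition V_rep i j := Representation (V_rel i j).
Definition P_rep := Representation P_rel.

Definition kchi (l : 'I_4) : lmodType D := repmod (chi_rep l).

Definition V (ij : Lambda) : lmodType D := repmod (V_rep (val ij).1 (val ij).2).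

Definition P1 (l : 'I_4) : lmodType D := repmod (tens xi2 P_rep (chi_rep l)).

End SimplesAndP.

End Double.

(* Main.v *)
Require Import Defs.
From HB Require Import structures.
From mathcomp Require Import all_boot all_order all_algebra.
From mathcomp Require Import boolp finmap monalg mxtens.
From mathcomp Require Import ring.

(** The theorem follows from the decomposition of the regular module. Once the
    sum M of the modules [P1 l] and of two copies of each [V ij] is known to be
    free of rank one over D, its summands are projective, and a nonzero map
    from one of them to a simple module is a projective cover as soon as the
    summand is local, that is, not the sum of two proper submodules
    ([local_projective_cover]). Each [V ij] is local because it is simple
    ([V_simple]), and [P1 l] because every vector with a nonzero component
    along its first basis vector generates it ([P1_local]). Every simple module
    is a quotient of the regular one, so it receives a nonzero map from a
    summand ([D_simple_surjected]).

    That D is isomorphic to M ([D_regular_iso]) is a dimension count. On the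
    one hand, the relations allow one to rewrite every element of D as a
    combination of the 64 monomials [x^l g^m a^i c^j] with [l, j < 2] and
    [m, i < 4] ([monomials_span]), which gives the upper bound 64 on the
    dimension without any basis theorem for D. On the other hand, M has
    dimension 4 * 4 + 12 * 4 = 64 and is cyclic ([D_generatorP]): it is
    generated by the sum of the first basis vectors of the [P1 l], of the first
    basis vectors of the first copies of the [V ij], and of the second basis
    vectors of their second copies. The elements a and g act diagonally with
    fourth roots of unity as eigenvalues, and projectors onto their joint
    eigenspaces separate these vectors ([cyclic_generator]). So the action on
    the generator is a surjection from D to M, and it must be bijective. *)

Set Implicit Arguments.
Unset Strict Implicit.
Unset Printing Implicit Defensive.

Import GRing.Theory.
Local Open Scope ring_scope.

(** * Local modules, projective covers and direct sums *)

Section ModuleTheory.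
Variable R : pzRingType.
Implicit Types M N P S : lmodType R.

Lemma submod_scale M (U : {pred M}) : submod_closed U ->
  forall a u, u \in U -> a *: u \in U.
Proof. by move=> [U0 UL] a u uU; rewrite -[a *: u]addr0; apply: UL. Qed.

Lemma submod_add M (U : {pred M}) : submod_closed U ->
  forall u v, u \in U -> v \in U -> u + v \in U.
Proof. by move=> [U0 UL] u v uU vU; rewrite -[u]scale1r; apply: UL. Qed.

(** A module is local when it is not the sum of two proper submodules; for a
    nonzero finitely generated module this says that it has a unique maximal
    submodule. It is the form of the property that makes a kernel superfluous. *)
Definition local M : Prop := forall U W : {pred M},
  submod_closed U -> submod_closed W ->
  (forall p, exists2 u, u \in U & exists2 w, w \in W & p = u + w) ->
  (forall p, p \in U) \/ (forall p, p \in W).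

(** [J] plays the part of the radical: when every vector outside [J] generates
    [M], a decomposition of one vector outside [J] forces one of the two
    summands to contain a generator. *)
Lemma local_of_radical M (J : M -> Prop) (m : M) :
  ~ J m -> (forall u v, J u -> J v -> J (u + v)) ->
  (forall U : {pred M}, submod_closed U ->
     forall u, u \in U -> ~ J u -> forall p, p \in U) ->
  local M.
Proof.
move=> Jm JD gen U W sU sW /(_ m)[u uU [w wW mE]].
have [Ju|/(gen U sU u uU)] := EM (J u); last by left.
have [Jw|/(gen W sW w wW)] := EM (J w); last by right.
by case: Jm; rewrite mE; apply: JD.
Qed.

Lemma simple_local S : simple S -> local S.
Proof.
move=> [[v /eqP v0] sS]; apply: (@local_of_radical _ (fun u => u = 0) v).
- exact/eqP.
- by move=> u w -> ->; rewrite addr0.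
- by move=> U /sS[U0|//] u /U0 ->.
Qed.

Lemma simple_surj M S (f : {linear M -> S}) :
  simple S -> (exists p, f p <> 0) -> surj f.
Proof.
move=> [_ sS] [p fp]; pose U : {pred S} := fun v => `[< exists q, f q = v >].
have sU : submod_closed U.
  split; first by apply/asboolP; exists 0; rewrite linear0.
  move=> a _ _ /asboolP[q <-] /asboolP[r <-]; apply/asboolP.
  by exists (a *: q + r); rewrite linearP.
case: (sS U sU) => [U0|UT v]; last exact/asboolP/UT.
by case: fp; apply: U0; apply/asboolP; exists p.
Qed.

(** The kernel of a nonzero map is a proper submodule, so in a local module it
    cannot be the one that exhausts a sum. *)
Lemma local_superfluous P S (f : {linear P -> S}) :
  local P -> (exists p, f p <> 0) -> superfluous_kernel f.
Proof.
move=> locP [p fp] U sU UK; pose W : {pred P} := fun w => f w == 0.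
have sW : submod_closed W.
  split; first by apply/eqP; exact: linear0.
  move=> a u v /eqP fu /eqP fv; apply/eqP.
  by rewrite linearP fu fv scaler0 addr0.
case: (locP U W sU sW) => // [q|WT].
  by have [u uU [w /eqP fw ->]] := UK q; exists u => //; exists w.
by case: fp; apply/eqP; exact: WT.
Qed.

Lemma local_projective_cover P S (f : {linear P -> S}) :
  projective P -> local P -> simple S -> (exists p, f p <> 0) ->
  projective_cover P S.
Proof.
move=> projP locP simS f0; split=> //; exists f.
by split; [apply: simple_surj|apply: local_superfluous].
Qed.

(** The map [p |-> s p *: m], where the scalars are read off by [s]: it is
    linear because [s] takes its values in the left regular module. *)
Section ActOn.
Variables (P : lmodType R) (s : {linear P -> R^o}) (M : lmodType R) (m : M).
Definition act_on (p : P) : M := (s p : R) *: m.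
Fact act_on_linear : linear act_on.
Proof. by move=> a p q; rewrite /act_on linearP scalerDl scalerA. Qed.
HB.instance Definition _ := GRing.isLinear.Build R P M *:%R act_on act_on_linear.
End ActOn.

(** The dual basis criterion for one generator: [p = s p *: e] for all [p], so
    that [h p = s p *: h e], and a preimage of the single vector [h e] lifts
    [h]. *)
Lemma cyclic_dual_basis_projective P (s : {linear P -> R^o}) (e : P) :
  (forall p, act_on s e p = p) -> projective P.
Proof.
move=> se M N f h /(_ (h e))[m fm]; exists (act_on s m) => p.
by rewrite /act_on linearZ /= fm -linearZ /= -/(act_on s e p) se.
Qed.

End ModuleTheory.

Section DirectSums.
Variables (R : pzRingType) (I : finType) (M : I -> lmodType R).

Definition dsum_inj i (u : M i) : dsum M := [ffun j => dfwith (fun j => 0 : M j) u j].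

Lemma dsum_injE i (u : M i) : dsum_inj u i = u.
Proof. by rewrite ffunE dfwith_in. Qed.

Lemma dsum_inj_out i j (u : M i) : i != j -> dsum_inj u j = 0.
Proof. by move=> ij; rewrite ffunE dfwith_out. Qed.

Fact dsum_inj_linear i : linear (@dsum_inj i).
Proof.
move=> a u v; apply/ffunP => j; rewrite [RHS]ffunE [in RHS]ffunE.
have [<-|ij] := eqVneq i j; first by rewrite !dsum_injE.
by rewrite !dsum_inj_out // scaler0 addr0.
Qed.
HB.instance Definition _ i :=
  GRing.isLinear.Build R (M i) (dsum M) *:%R (@dsum_inj i) (@dsum_inj_linear i).

Lemma dsum_sumE (J : Type) (r : seq J) (Q : pred J) (F : J -> dsum M) i :
  (\sum_(j <- r | Q j) F j) i = \sum_(j <- r | Q j) F j i.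
Proof. by apply: (big_morph (fun u : dsum M => u i)) => [u v|]; rewrite ffunE. Qed.

Lemma dsum_decomp (u : dsum M) : u = \sum_i dsum_inj (u i).
Proof.
apply/ffunP => j; rewrite dsum_sumE (bigD1 j) //= dsum_injE big1 ?addr0 //.
by move=> i ij; rewrite dsum_inj_out.
Qed.

End DirectSums.

Section Retracts.
Variable R : pzRingType.
Implicit Types M N Q S : lmodType R.

Definition retract M Q : Prop :=
  exists (i : {linear Q -> M}) (p : {linear M -> Q}), cancel i p.

Lemma retract_trans M N Q : retract M N -> retract N Q -> retract M Q.
Proof.
move=> [i [p ip]] [j [q jq]]; exists (i \o j), (q \o p) => u /=.
by rewrite ip jq.
Qed.

Definition pair_inl M N (u : M) : M * N := (u, 0).
Definition pair_inr M N (v : N) : M * N := (0, v).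

Fact pair_inl_linear M N : linear (@pair_inl M N).
Proof. by move=> a u v; congr (_, _) => /=; rewrite scaler0 addr0. Qed.
Fact pair_inr_linear M N : linear (@pair_inr M N).
Proof. by move=> a u v; congr (_, _) => /=; rewrite scaler0 addr0. Qed.
HB.instance Definition _ M N :=
  GRing.isLinear.Build R M (M * N)%type *:%R (@pair_inl M N) (@pair_inl_linear M N).
HB.instance Definition _ M N :=
  GRing.isLinear.Build R N (M * N)%type *:%R (@pair_inr M N) (@pair_inr_linear M N).

Lemma retract_pairl M N : retract (M * N)%type M.
Proof. by exists (@pair_inl M N), fst. Qed.

Lemma retract_pairr M N : retract (M * N)%type N.
Proof. by exists (@pair_inr M N), snd. Qed.

Lemma pair_decomp M N (u : M * N) : u = pair_inl N u.1 + pair_inr M u.2.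
Proof. by rewrite [LHS]surjective_pairing; congr (_, _) => /=; rewrite (addr0, add0r). Qed.

Section DsumProj.
Variables (I : finType) (F : I -> lmodType R) (i : I).
Definition dsum_proj (u : dsum F) : F i := u i.
Fact dsum_proj_linear : linear dsum_proj.
Proof. by move=> a u v; rewrite /dsum_proj !ffunE. Qed.
HB.instance Definition _ :=
  GRing.isLinear.Build R (dsum F) (F i) *:%R dsum_proj dsum_proj_linear.
End DsumProj.

Lemma retract_dsum (I : finType) (F : I -> lmodType R) i : retract (dsum F) (F i).
Proof. exists (@dsum_inj _ _ F i), (@dsum_proj _ F i) => u; exact: dsum_injE. Qed.

Lemma iso_inverse M N (f : {linear M -> N}) :
  bijective f -> exists h : {linear N -> M}, cancel h f.
Proof.
move=> [h fK hK]; have h_lin : linear h.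
  by move=> a u v; apply: (can_inj fK); rewrite linearP !hK.
pose hL := GRing.isLinear.Build R N M *:%R h h_lin.
by exists (HB.pack_for {linear N -> M} h hL).
Qed.

(** The inclusion of [Q] in the regular module, together with the image in [Q]
    of the unit of [R], is a one-element dual basis. *)
Lemma retract_iso_regular_projective M Q :
  iso R^o M -> retract M Q -> projective Q.
Proof.
move=> [f /iso_inverse[h hK]] [i [p ip]].
apply: (@cyclic_dual_basis_projective R Q (h \o i) (p (f 1))) => q.
rewrite /act_on /= -linearZ /= -linearZ /=.
by rewrite [_ *: _]mulr1 hK ip.
Qed.

(** Any vector [v] is the image of 1 under the map [r |-> r *: v] on the regular
    module. *)
Lemma iso_regular_nonzero_map M S :
  iso R^o M -> (exists v : S, v <> 0) -> exists h : {linear M -> S}, exists m, h m <> 0.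
Proof.
move=> [f fbij] [v v0]; have [h hK] := iso_inverse fbij.
have fI : injective f by case: fbij => f' fK _; apply: can_inj fK.
have act1 : act_on h v (f 1) = v by rewrite /act_on (fI _ _ (hK (f 1))) scale1r.
by exists (act_on h v), (f 1); change (act_on h v (f 1) <> 0); rewrite act1.
Qed.

End Retracts.

(** The shape of the decomposition of the regular module, in which every
    two-dimensional module occurs twice. *)
Section SumOfPairs.
Variables (R : pzRingType) (I J : finType) (P : I -> lmodType R) (Q Q' : J -> lmodType R).

Definition sum_of_pairs : lmodType R :=
  (dsum P * dsum (fun j => (Q j * Q' j)%type))%type.

Definition sum_inj i : {linear P i -> sum_of_pairs} :=
  @pair_inl _ _ _ \o @dsum_inj _ _ P i.
Definition sum_injl j : {linear Q j -> sum_of_pairs} :=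
  @pair_inr _ _ _ \o (@dsum_inj _ _ (fun j => (Q j * Q' j)%type) j \o @pair_inl _ _ _).
Definition sum_injr j : {linear Q' j -> sum_of_pairs} :=
  @pair_inr _ _ _ \o (@dsum_inj _ _ (fun j => (Q j * Q' j)%type) j \o @pair_inr _ _ _).

Lemma sum_of_pairs_decomp (m : sum_of_pairs) :
  m = \sum_i sum_inj i (m.1 i) +
      (\sum_j sum_injl j (m.2 j).1 + \sum_j sum_injr j (m.2 j).2).
Proof.
rewrite {1}[m]pair_decomp {1}[m.1]dsum_decomp {1}[m.2]dsum_decomp !linear_sum.
congr (_ + _); rewrite -big_split; apply: eq_bigr => j _ /=.
by rewrite {1}[m.2 j]pair_decomp !linearD.
Qed.

Lemma retract_sum_inj i : retract sum_of_pairs (P i).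
Proof. exact: retract_trans (retract_pairl _ _) (retract_dsum _ _). Qed.

Lemma retract_sum_injl j : retract sum_of_pairs (Q j).
Proof.
apply: retract_trans (retract_pairr _ _) _.
apply: retract_trans (retract_dsum _ j) _; exact: retract_pairl.
Qed.

Lemma sum_of_pairs_nonzero_map (S : lmodType R) (h : {linear sum_of_pairs -> S}) m :
  h m <> 0 ->
  [\/ exists i, exists q, (h \o sum_inj i) q <> 0,
      exists j, exists q, (h \o sum_injl j) q <> 0 |
      exists j, exists q, (h \o sum_injr j) q <> 0].
Proof.
move=> hm; apply: contrapT => nh; apply: hm.
have zero (K : finType) (F : K -> sum_of_pairs) :
    (forall i, h (F i) = 0) -> h (\sum_i F i) = 0.
  by move=> hF; rewrite linear_sum big1.
rewrite [m]sum_of_pairs_decomp !linearD !zero ?addr0 // => i; apply: contrapT => hi.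
- by apply: nh; apply: Or33; exists i, (m.2 i).2.
- by apply: nh; apply: Or32; exists i, (m.2 i).1.
- by apply: nh; apply: Or31; exists i, (m.1 i).
Qed.
End SumOfPairs.

(** * Presented algebras *)

Lemma scale_mkmalgU (M : monomType) (R : nzRingType) (c : R) (w : M) :
  c *: << w >> = << c *g w >> :> {malg R[M]}.
Proof. by apply/malgP => v; rewrite mcoeffZ !mcoeffU mulrnAr mulr1. Qed.

Section PresentedAlgebra.
Variables (k : fieldType) (X : choiceType) (E : seq (free_alg k X * free_alg k X)).
Local Notation pi := (pi_presented E).

(** The structure map of the algebra: [presented E] only carries a ring
    structure, so the base field acts through this central subring. *)
Definition scalar_of (c : k) : presented E := pi (c *: 1).
Definition gen_of (x : X) : presented E := pi (var k x).

Lemma pi_rel p : p \in E -> pi p.1 = pi p.2.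
Proof.
move=> pE; apply/pi_presentedP/asboolP; exists [:: ((1, p), 1)].
  by move=> v; rewrite inE => /eqP ->.
by rewrite big_seq1 /= mul1r mulr1.
Qed.

Lemma piM f g : pi (f * g) = pi f * pi g.
Proof. exact/esym/pi_presentedM. Qed.

Lemma piZ c f : pi (c *: f) = scalar_of c * pi f.
Proof. by rewrite -piM -scalerAl mul1r. Qed.

Lemma pi0 : pi 0 = 0.
Proof. exact: raddf0. Qed.

Lemma piN f : pi (- f) = - pi f.
Proof. exact: raddfN. Qed.

Lemma pi1 : pi 1 = 1.
Proof. by []. Qed.

Lemma piX2 f : pi (f ^+ 2) = pi f * pi f.
Proof. exact: piM. Qed.

Lemma piX4 f : pi (f ^+ 4) = pi f * pi f * (pi f * pi f).
Proof. by rewrite (exprD f 2 2) piM piX2. Qed.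

Lemma scalarD c d : scalar_of (c + d) = scalar_of c + scalar_of d.
Proof. by rewrite /scalar_of scalerDl pi_presentedD. Qed.

Lemma scalarM c d : scalar_of (c * d) = scalar_of c * scalar_of d.
Proof. by rewrite {1}/scalar_of -scalerA piZ. Qed.

Lemma scalar1 : scalar_of 1 = 1.
Proof. by rewrite /scalar_of scale1r. Qed.

Lemma scalar0 : scalar_of 0 = 0.
Proof. by apply: (addrI (scalar_of 0)); rewrite -scalarD !addr0. Qed.

Lemma scalarN c : scalar_of (- c) = - scalar_of c.
Proof. by apply: (addrI (scalar_of c)); rewrite -scalarD !subrr scalar0. Qed.

Lemma scalarC c y : y * scalar_of c = scalar_of c * y.
Proof.
have central (f : free_alg k X) : f * (c *: 1) = (c *: 1) * f.
  have -> : c *: 1 = << c *g (mone : {fmonom X}) >> :> free_alg k X.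
    exact: scale_mkmalgU.
  by rewrite [LHS]fgmulgU [RHS]fgmulUg; apply: eq_bigr => w _; rewrite mulm1 mul1m mulrC.
by rewrite -[y]repr_presentedK -!piM central.
Qed.

Lemma scalarB c d : scalar_of (c - d) = scalar_of c - scalar_of d.
Proof. by rewrite scalarD scalarN. Qed.

(** Words in the generators span the free algebra, and each of them is obtained
    from 1 by left multiplications. *)
Lemma presented_ind (S : presented E -> Prop) :
  S 1 -> (forall u v, S u -> S v -> S (u + v)) ->
  (forall c u, S u -> S (scalar_of c * u)) ->
  (forall x u, S u -> S (gen_of x * u)) -> forall y, S y.
Proof.
move=> S1 SD SZ SX y; rewrite -[y]repr_presentedK; move: (repr_presented y) => f.
have S0 : S 0 by rewrite -(mul0r 1) -scalar0; apply: SZ.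
rewrite (monalgE f) (big_morph pi (@pi_presentedD k X E) pi0).
apply: big_ind => // w _.
have -> : << f@_w *g w >> = f@_w *: << w >>.
  exact/esym/scale_mkmalgU.
change (S (pi (f@_w *: << w >>))).
rewrite piZ; apply: SZ; case: w => w.
elim: w => [|x w IH]; first by have := S1; rewrite -[1]/(pi 1) -[1]/(<< fmone _ >>) fmoneE.
have -> : << FMonom (x :: w) >> = var k x * << FMonom w >> :> free_alg k X.
  rewrite /var -lock [RHS]fgmulUU mulr1 fmuE; congr << _ *g _ >>.
  by apply/val_inj; rewrite /= fmM.
by rewrite piM; apply: SX.
Qed.

End PresentedAlgebra.

Section RepModules.
Variables (k : fieldType) (X : choiceType) (E : seq (free_alg k X * free_alg k X)).

(** Linearity over a presented algebra is checked on its generators. *)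
Lemma presented_linear (M N : lmodType (presented E)) (f : M -> N) :
  {morph f : u v / u + v} -> (forall s u, f (scalar_of E s *: u) = scalar_of E s *: f u) ->
  (forall x u, f (gen_of E x *: u) = gen_of E x *: f u) -> linear f.
Proof.
move=> fD fZ fX y u v; rewrite fD; congr (_ + _); move: u.
elim/presented_ind: y => [u|y z IHy IHz u|s y IH u|x y IH u].
- by rewrite !scale1r.
- by rewrite !scalerDl fD IHy IHz.
- by rewrite -!scalerA fZ IH.
- by rewrite -!scalerA fX IH.
Qed.

HB.instance Definition _ := GRing.isZmodMorphism.Build k (presented E) (scalar_of E) (scalarB E).
HB.instance Definition _ := GRing.isMonoidMorphism.Build k (presented E) (scalar_of E)
   (conj (scalar1 E) (@scalarM k X E)).

Variables (n : nat) (rho : representation E n).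

Lemma gen_of_scale h (v : repmod rho) : gen_of E h *: v = rho h *m v.
Proof. by rewrite -[LHS]/(repmx rho _ *m v) repmx_pi evalmx_var. Qed.

Lemma scalar_of_scale s (v : repmod rho) : scalar_of E s *: v = s *: (v : 'cV[k]_n).
Proof. by rewrite -[LHS]/(repmx rho _ *m v) repmx_pi evalmxZ evalmx1 -scalemxAl mul1mx. Qed.

End RepModules.

(** * A spanning set of 64 monomials *)

(** The relations of the presentation from which the rewriting below proceeds.
    They are stated in an arbitrary ring over [k], because computing in the
    quotient of a free algebra makes conversion unfold the quotient. The
    generators [b] and [d] are eliminated by [b = a ^+ 2 * c] and
    [d = a ^+ 3]. *)
Record D_ring_relations (k : fieldType) (xi sqrt2 : k) (A : pzRingType)
    (sc : k -> A) (a b c d x g : A) : Prop := {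
  ring_ac : a * c = sc xi * (c * a);
  ring_ad : a * d = 1;
  ring_c2 : c * c = 0;
  ring_a2c : a * a * c = b;
  ring_a4 : a * a * (a * a) = 1;
  ring_g4 : g * g * (g * g) = 1;
  ring_x2 : x * x = g * g - 1;
  ring_gx : g * x = - (x * g);
  ring_ag : a * g = g * a;
  ring_cg : c * g = - (g * c);
  ring_ax : a * x + sc xi * (x * a) = sc (sqrt2 * xi) * (b + g * c);
  ring_cx : c * x + sc xi * (x * c) = sc (sqrt2 * xi) * (d - g * a) }.

Section Spanning.
Variables (k : fieldType) (xi sqrt2 : k).
Hypothesis xi2 : xi ^+ 2 = -1.
Variables (A : pzRingType) (sc : {rmorphism k -> A}).
Hypothesis scC : forall s y, y * sc s = sc s * y.
Variables a b c d x g : A.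
Hypothesis rels : D_ring_relations xi sqrt2 sc a b c d x g.

Definition monomial (l m i j : nat) : A := x ^+ l * (g ^+ m * (a ^+ i * c ^+ j)).

Definition exponents : finType := ('I_2 * ('I_4 * ('I_4 * 'I_2)))%type.

Definition monomial_comb (C : {ffun exponents -> k^o}) : A :=
  \sum_(w : exponents) sc (C w) * monomial w.1 w.2.1 w.2.2.1 w.2.2.2.

Definition spanned (y : A) : Prop := exists C, y = monomial_comb C.

Lemma monomial_combD C C' : monomial_comb (C + C') = monomial_comb C + monomial_comb C'.
Proof. by rewrite /monomial_comb -big_split; apply: eq_bigr => w _; rewrite ffunE rmorphD mulrDl. Qed.

Lemma monomial_combZ s (C : {ffun exponents -> k^o}) : monomial_comb (s *: C) = sc s * monomial_comb C.
Proof. by rewrite /monomial_comb mulr_sumr; apply: eq_bigr => w _; rewrite ffunE rmorphM mulrA. Qed.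

Lemma spannedD y z : spanned y -> spanned z -> spanned (y + z).
Proof. by move=> [C ->] [C' ->]; exists (C + C'); rewrite monomial_combD. Qed.

Lemma spannedZ s y : spanned y -> spanned (sc s * y).
Proof. by move=> [C ->]; exists (s *: C); rewrite monomial_combZ. Qed.

Lemma spannedN y : spanned y -> spanned (- y).
Proof. by rewrite -mulN1r -(rmorph1 sc) -rmorphN; apply: spannedZ. Qed.

Lemma spanned0 : spanned 0.
Proof.
exists 0; rewrite /monomial_comb big1 // => w _; rewrite ffunE rmorph0.
exact: mul0r.
Qed.

Lemma spanned_monomial l m i j : (l < 2)%N -> spanned (monomial l m i j).
Proof.
move=> l2; have [j2|j2] := ltnP j 2; last first.
  have -> : monomial l m i j = 0; last exact: spanned0.
  by rewrite /monomial -(subnKC j2) exprD expr2 (ring_c2 rels) mul0r !mulr0.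
have mod4 (y : A) n : y * y * (y * y) = 1 -> y ^+ n = y ^+ (n %% 4).
  move=> y4; rewrite {1}(divn_eq n 4) mulnC exprD exprM (exprD y 2 2) expr2 y4.
  by rewrite expr1n mul1r.
have lt4 n : (n %% 4 < 4)%N by rewrite ltn_mod.
pose v : exponents :=
  (Ordinal l2, (Ordinal (lt4 m), (Ordinal (lt4 i), Ordinal j2))).
exists [ffun w => (w == v)%:R]; rewrite /monomial_comb (bigD1 v) //= ffunE eqxx rmorph1.
rewrite [1 * _]mul1r big1 ?addr0 => [|w /negPf wv]; last first.
  by rewrite ffunE wv rmorph0; apply: mul0r.
rewrite /monomial; congr (_ * (_ * (_ * _))); apply: mod4.
  exact: ring_g4 rels.
exact: ring_a4 rels.
Qed.

(** [- xi] is the inverse of [xi]. *)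
Lemma xi_flip (y z : A) : y = sc xi * z -> z = sc (- xi) * y.
Proof. by move=> ->; rewrite mulrA -rmorphM mulNr -expr2 xi2 opprK rmorph1 mul1r. Qed.

Lemma skew_exp (y z : A) s n : y * z = sc s * (z * y) ->
  y * z ^+ n = sc (s ^+ n) * (z ^+ n * y).
Proof.
move=> yz; elim: n => [|n IH]; first by rewrite !expr0 rmorph1 !mul1r mulr1.
rewrite !exprS rmorphM mulrA yz -!mulrA IH; congr (_ * _).
by rewrite mulrA scC !mulrA.
Qed.

Lemma mul_a_monomial m i j : a * monomial 0 m i j = monomial 0 m i.+1 j.
Proof.
have ag : a * g = sc 1 * (g * a) by rewrite (ring_ag rels) rmorph1 mul1r.
rewrite /monomial !expr0 !mul1r mulrA (skew_exp m ag) expr1n rmorph1.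
by rewrite mul1r exprS !mulrA.
Qed.

Lemma mul_g_monomial m i j : g * monomial 0 m i j = monomial 0 m.+1 i j.
Proof. by rewrite /monomial !expr0 !mul1r exprS -!mulrA. Qed.

Lemma mul_c_monomial m i j :
  c * monomial 0 m i j = sc ((-1) ^+ m * (- xi) ^+ i) * monomial 0 m i j.+1.
Proof.
have cg : c * g = sc (- 1) * (g * c).
  by rewrite rmorphN rmorph1 mulN1r (ring_cg rels).
have ca : c * a = sc (- xi) * (a * c) by exact/xi_flip/(ring_ac rels).
rewrite /monomial !expr0 !mul1r mulrA (skew_exp m cg) rmorphM exprS -!mulrA.
congr (_ * _); rewrite [c * _]mulrA (skew_exp i ca) -!mulrA.
by rewrite mulrA scC -!mulrA.
Qed.

Lemma ring_d_a3 : d = a * (a * a).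
Proof.
by rewrite -[d]mul1r -(ring_a4 rels) -!mulrA (ring_ad rels) mulr1.
Qed.

Lemma spanned_mul_x_monomial m i j : spanned (x * monomial 0 m i j).
Proof.
have -> : x * monomial 0 m i j = monomial 1 m i j by rewrite /monomial expr0 mul1r.
exact: spanned_monomial.
Qed.

(** Moving [a] past [x] costs a term in [b + g * c], which involves no [x] any
    more: the ordering of the monomials with [x] in front lets the rewriting
    terminate after one step. *)
Lemma spanned_mul_a l m i j : (l < 2)%N -> spanned (a * monomial l m i j).
Proof.
case: l => [|[|//]] _; first by rewrite mul_a_monomial; apply: spanned_monomial.
have -> : monomial 1 m i j = x * monomial 0 m i j by rewrite /monomial expr0 mul1r.
have ax : a * x = sc (- xi) * (x * a) + sc (sqrt2 * xi) * (b + g * c).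
  by rewrite -(ring_ax rels) rmorphN addrCA mulNr addNr addr0.
rewrite mulrA ax mulrDl -!mulrA mul_a_monomial -(ring_a2c rels).
apply: spannedD; apply: spannedZ; first exact: spanned_mul_x_monomial.
rewrite mulrDl -!mulrA mul_c_monomial; set s := sc _.
rewrite !(mulrA _ s) !scC -!mulrA mul_g_monomial !(mulrA a s) scC -!mulrA.
rewrite !mul_a_monomial.
by apply: spannedD; apply: spannedZ; apply: spanned_monomial.
Qed.

Lemma spanned_mul_c l m i j : (l < 2)%N -> spanned (c * monomial l m i j).
Proof.
case: l => [|[|//]] _.
  by rewrite mul_c_monomial; apply: spannedZ; apply: spanned_monomial.
have -> : monomial 1 m i j = x * monomial 0 m i j by rewrite /monomial expr0 mul1r.
have cx : c * x = sc (- xi) * (x * c) + sc (sqrt2 * xi) * (d - g * a).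
  by rewrite -(ring_cx rels) rmorphN addrCA mulNr addNr addr0.
rewrite mulrA cx mulrDl -!mulrA; apply: spannedD; apply: spannedZ.
  rewrite mul_c_monomial mulrA scC -mulrA.
  by apply: spannedZ; apply: spanned_mul_x_monomial.
rewrite ring_d_a3 mulrBl -!mulrA !mul_a_monomial mul_g_monomial.
by apply: spannedD; [|apply: spannedN]; apply: spanned_monomial.
Qed.

Lemma spanned_mul_g l m i j : (l < 2)%N -> spanned (g * monomial l m i j).
Proof.
case: l => [|[|//]] _; first by rewrite mul_g_monomial; apply: spanned_monomial.
have -> : monomial 1 m i j = x * monomial 0 m i j by rewrite /monomial expr0 mul1r.
rewrite mulrA (ring_gx rels) mulNr -mulrA mul_g_monomial.
by apply: spannedN; apply: spanned_mul_x_monomial.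
Qed.

Lemma spanned_mul_x l m i j : (l < 2)%N -> spanned (x * monomial l m i j).
Proof.
case: l => [|[|//]] _; first exact: spanned_mul_x_monomial.
have -> : monomial 1 m i j = x * monomial 0 m i j by rewrite /monomial expr0 mul1r.
rewrite mulrA (ring_x2 rels) mulrBl mul1r -mulrA !mul_g_monomial.
by apply: spannedD; [|apply: spannedN]; apply: spanned_monomial.
Qed.

(** The induction principle of an algebra generated by six elements, in terms
    of left multiplications only. *)
Definition generating : Prop := forall S : A -> Prop,
  S 1 -> (forall u v, S u -> S v -> S (u + v)) ->
  (forall s u, S u -> S (sc s * u)) ->
  (forall u, S u -> [/\ S (a * u), S (b * u), S (c * u) &
                        [/\ S (d * u), S (x * u) & S (g * u)]]) ->
  forall y, S y.

(** The upper bound 64 on the dimension: the span of the monomials contains 1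
    and is stable under left multiplication by every generator. *)
Lemma monomials_span : generating -> forall y, spanned y.
Proof.
have stable z u :
    (forall l m i j, (l < 2)%N -> spanned (z * monomial l m i j)) ->
    spanned u -> spanned (z * u).
  move=> zmon [C ->]; rewrite /monomial_comb mulr_sumr.
  apply: big_ind => [||w _]; [exact: spanned0|exact: spannedD|].
  by rewrite mulrA scC -mulrA; apply/spannedZ/zmon.
have sa u := @stable a u spanned_mul_a; have sc' u := @stable c u spanned_mul_c.
apply; [|exact: spannedD|exact: spannedZ|].
- have -> : 1 = monomial 0 0 0 0 by rewrite /monomial !expr0 !mul1r.
  exact: spanned_monomial.
move=> u su; split; [| | |split].
- exact: sa.
- by rewrite -(ring_a2c rels) -!mulrA; apply/sa/sa/sc'.
- exact: sc'.
- by rewrite ring_d_a3 -!mulrA; apply/sa/sa/sa.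
- exact/stable/su/spanned_mul_x.
- exact/stable/su/spanned_mul_g.
Qed.

End Spanning.

(** Rewriting with the morphism properties of the projection would compare
    polynomials up to conversion; following the syntax of [t] instead, this
    builds the proof that the class of [t] modulo [E] is the same expression in
    the classes of the generators. *)
Local Ltac pi_proof E t :=
  lazymatch t with
  | ?u + ?v => let p := pi_proof E u in let q := pi_proof E v in
      constr:(etrans (pi_presentedD E u v) (f_equal2 (fun y z => y + z) p q))
  | - ?u => let p := pi_proof E u in
      constr:(etrans (piN E u) (f_equal (fun y => - y) p))
  | ?u * ?v => let p := pi_proof E u in let q := pi_proof E v in
      constr:(etrans (piM E u v) (f_equal2 (fun y z => y * z) p q))
  | ?e *: ?u => let p := pi_proof E u in
      constr:(etrans (piZ E e u) (f_equal (fun y => scalar_of E e * y) p))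
  | var _ ?h => constr:(erefl (gen_of E h))
  | ?u ^+ 2 => let p := pi_proof E u in constr:(etrans (piX2 E u)
      (f_equal (fun y => y * y) p))
  | ?u ^+ 4 => let p := pi_proof E u in constr:(etrans (piX4 E u)
      (f_equal (fun y => y * y * (y * y)) p))
  | 1 => constr:(pi1 E)
  | 0 => constr:(pi0 E)
  end.

Local Ltac pi_intro H :=
  lazymatch goal with |- (pi_presented ?E ?u = pi_presented ?E ?v) /\ _ -> _ =>
    let p := pi_proof E u in let q := pi_proof E v in
    case=> H; move: (etrans (esym p) (etrans H q)) => {H}; cbv beta; move=> H
  end.

Lemma D_ring_relationsP (k : fieldType) (xi sqrt2 : k) :
  let E := D_relations xi sqrt2 in
  D_ring_relations xi sqrt2 (scalar_of E) (gen_of E Ga) (gen_of E Gb)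
    (gen_of E Gc) (gen_of E Gd) (gen_of E Gx) (gen_of E Gg).
Proof.
cbv zeta.
have rels E : E = D_relations xi sqrt2 ->
    foldr (fun p Q => pi_presented E p.1 = pi_presented E p.2 /\ Q) True
      (D_relations xi sqrt2).
  by move=> <-; apply/all_inP => p; apply: pi_rel.
(* Only the list of relations is to be unfolded, not its occurrence in the type
   of the classes: the latter is replaced by a variable. *)
have [E EE] : exists E, E = D_relations xi sqrt2 by eexists.
move: (rels E EE) => {rels}; rewrite /D_relations.
cbv beta iota delta [foldr fst snd].
pi_intro ab; pi_intro ac; pi_intro cb; pi_intro bc; pi_intro cd; pi_intro bd.
pi_intro da; pi_intro ad; pi_intro b2; pi_intro c2; pi_intro a2c; pi_intro a4.
pi_intro g4; pi_intro x2; pi_intro gx; pi_intro ag; pi_intro bg; pi_intro cg.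
pi_intro dg; pi_intro ax; pi_intro bx; pi_intro cx; pi_intro dx => _; subst E.
exact: (Build_D_ring_relations ac ad c2 a2c a4 g4 x2 gx ag cg ax cx).
Qed.

Lemma D_generating (k : fieldType) (xi sqrt2 : k) :
  let E := D_relations xi sqrt2 in
  generating (scalar_of E) (gen_of E Ga) (gen_of E Gb) (gen_of E Gc)
    (gen_of E Gd) (gen_of E Gx) (gen_of E Gg).
Proof.
move=> E S S1 SD SZ SX y; elim/presented_ind: y => [||| h u].
- exact: S1.
- exact: SD.
- exact: SZ.
move=> /SX[sa sb sc [sd sx sg]]; case: h.
- exact: sa.
- exact: sb.
- exact: sc.
- exact: sd.
- exact: sx.
- exact: sg.
Qed.

(** * Cyclic modules: weights and dimensions *)

Section Weights.
Variables (k : fieldType).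
Hypothesis two_neq0 : 2 != 0 :> k.
Variables (A : pzRingType) (sc : {rmorphism k -> A}) (M : lmodType A).
Hypothesis scC : forall s y, y * sc s = sc s * y.

(** The Lagrange idempotent: for [y ^+ 4 = 1] this is the projector
    [1/4 * \sum_n (y / s) ^+ n] onto the [s]-eigenspace of [y], with the
    inverse powers of [s] written as powers thanks to [s ^+ 4 = 1]. *)
Definition eigen_proj (y : A) (s : k) : A :=
  sc 4^-1 * (1 + sc (s ^+ 3) * y + sc (s ^+ 2) * (y * y) + sc s * (y * (y * y))).

Lemma eigen_projE y s t (u : M) : s ^+ 4 = 1 -> t ^+ 4 = 1 -> y *: u = sc t *: u ->
  eigen_proj y s *: u = if t == s then u else 0.
Proof.
move=> s4 t4 yu; have four0 : 4 != 0 :> k.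
  by rewrite (_ : 4 = 2 * 2) ?mulf_neq0 // -natrM.
have scZ r r' : sc r *: (sc r' *: u) = sc (r * r') *: u by rewrite scalerA rmorphM.
have yZ r : y *: (sc r *: u) = sc (r * t) *: u.
  by rewrite scalerA scC -scalerA yu scZ.
have -> : eigen_proj y s *: u =
    sc (4^-1 * (1 + s ^+ 3 * t + s ^+ 2 * t ^+ 2 + s * t ^+ 3)) *: u.
  rewrite /eigen_proj -scalerA !scalerDl scale1r -!scalerA yu !yZ !scZ.
  by rewrite -{1}[u]scale1r -(rmorph1 sc) -!scalerDl -!rmorphD scZ !exprS expr0 !mulrA !mulr1.
have [->|ts] := eqVneq t s.
  rewrite (_ : _ * _ = 1) ?rmorph1 ?scale1r //.
  by field: s4.
rewrite (_ : _ * _ = 0) ?rmorph0 ?scale0r //.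
apply: (mulfI (_ : t - s != 0)); first by rewrite subr_eq0.
by field: s4 t4.
Qed.

End Weights.

(** The abstract form of the argument that the sum of the modules is cyclic.
    The vectors [p i] stand for the tops of the projective covers of the
    characters; [v j, w j] and [v' j, w' j] stand for the standard bases of
    the two copies of the [j]-th two-dimensional module. The generator
    involves [v j] in the first copy but [w' j] in the second one: two copies of
    the same basis vector could not be told apart by any element of the
    algebra. *)
Section CyclicGenerator.
Variables (k : fieldType) (xi : k).
Hypothesis two_neq0 : 2 != 0 :> k.
Hypothesis xi2 : xi ^+ 2 = -1.
Variables (A : pzRingType) (sc : {rmorphism k -> A}) (M : lmodType A).
Hypothesis scC : forall s y, y * sc s = sc s * y.
Variables a c x g : A.
Variables (I J : finType).

Definition weight_vector (s t : k) (u : M) : Prop :=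
  a *: u = sc s *: u /\ g *: u = sc t *: u.

Variables (p : I -> M) (lam : I -> k).
Hypothesis p_weight : forall i, weight_vector (lam i) (lam i ^+ 2) (p i).
Hypothesis lam4 : forall i, lam i ^+ 4 = 1.
Hypothesis lam_inj : injective lam.

Variables (v w v' w' : J -> M) (alpha beta gamma : J -> k).
Hypothesis v_weight : forall j, weight_vector (alpha j) (beta j) (v j).
Hypothesis w'_weight : forall j, weight_vector (- xi * alpha j) (- beta j) (w' j).
Hypothesis alpha4 : forall j, alpha j ^+ 4 = 1.
Hypothesis beta4 : forall j, beta j ^+ 4 = 1.
Hypothesis beta_neq : forall j, beta j != alpha j ^+ 2.
Hypothesis alpha_beta_inj : forall j j', alpha j = alpha j' -> beta j = beta j' -> j = j'.
Hypothesis gamma_neq0 : forall j, gamma j != 0.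
Hypothesis cv : forall j, c *: v j = 0.
Hypothesis cw' : forall j, c *: w' j = v' j.
Hypothesis xv : forall j, x *: v j = sc (gamma j) *: w j.
Hypothesis xv' : forall j, x *: v' j = sc (gamma j) *: w' j.

Definition weight_proj (s t : k) : A := eigen_proj sc a s * eigen_proj sc g t.

Lemma weight_projE s t s' t' u : s ^+ 4 = 1 -> t ^+ 4 = 1 -> s' ^+ 4 = 1 ->
  t' ^+ 4 = 1 -> weight_vector s' t' u ->
  weight_proj s t *: u = if (s' == s) && (t' == t) then u else 0.
Proof.
move=> s4 t4 s'4 t'4 [au gu]; rewrite -scalerA (eigen_projE two_neq0 scC t4 t'4 gu).
case: (t' == t); last by rewrite scaler0 andbF.
by rewrite andbT (eigen_projE two_neq0 scC s4 s'4 au).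
Qed.

(** All weights [(s, t)] of the [p i] satisfy [t = s ^+ 2] and none of the other
    ones does, so weight projectors separate the two kinds. The weight
    component of the generator at the weight of [w' j] consists of [w' j] and
    of vectors [v j'], which [c] kills, while [c] maps [w' j] to [v' j]; this
    isolates the second copy. Once it is removed, distinct remaining vectors
    have distinct weights. *)
Lemma cyclic_generator (N : M -> Prop) :
  (forall u u', N u -> N u' -> N (u + u')) -> (forall r u, N u -> N (r *: u)) ->
  N (\sum_i p i + (\sum_j v j + \sum_j w' j)) ->
  [/\ forall i, N (p i), forall j, N (v j), forall j, N (w j), forall j, N (v' j)
    & forall j, N (w' j)].
Proof.
move=> ND NZ Nm.
have N_sc s u : s != 0 -> N (sc s *: u) -> N u.
  by move=> s0 /(NZ (sc s^-1)); rewrite scalerA -rmorphM mulVf // rmorph1 scale1r.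
have N_cancel u u' : N (u + u') -> N u' -> N u.
  move=> Nuu' Nu'; rewrite -[u](addrK u'); apply: ND => //.
  by rewrite -scaleN1r; apply: NZ.
have N_sum (K : finType) (u : K -> M) : (forall i, N (u i)) -> N (\sum_i u i).
  by move=> Nu; apply: big_ind => //; rewrite -(scale0r (\sum_i p i + (\sum_j v j + \sum_j w' j))); apply: NZ.
have lam_sqr4 i : (lam i ^+ 2) ^+ 4 = 1 by rewrite -exprM mulnC exprM lam4 expr1n.
have xalpha4 j : (- xi * alpha j) ^+ 4 = 1.
  by ring: (alpha4 j) xi2.
have nbeta4 j : (- beta j) ^+ 4 = 1 by ring: (beta4 j).
have Nv' j : N (v' j).
  have := NZ c _ (NZ (weight_proj (- xi * alpha j) (- beta j)) _ Nm).
  rewrite !scalerDr !scaler_sumr.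
  rewrite big1 ?add0r => [|i _]; last first.
    rewrite (weight_projE _ _ _ _ (p_weight i)) //.
    case: ifP => [/andP[/eqP li /eqP bj]|_]; last exact: scaler0.
    case/eqP: (beta_neq j); apply: oppr_inj; rewrite -bj li.
    by ring: xi2.
  rewrite big1 ?add0r => [|j' _]; last first.
    rewrite (weight_projE _ _ _ _ (v_weight j')) //.
    by case: ifP => _; rewrite ?cv ?scaler0.
  rewrite (bigD1 j) //= (weight_projE _ _ _ _ (w'_weight j)) // !eqxx /= cw'.
  rewrite big1 ?addr0 // => j' /eqP j'j.
  rewrite (weight_projE _ _ _ _ (w'_weight j')) //.
  case: ifP => [/andP[/eqP ea /eqP eb]|_]; last exact: scaler0.
  case: j'j; apply: alpha_beta_inj; last exact: oppr_inj.
  apply: (mulfI (_ : - xi != 0)) => //; rewrite oppr_eq0.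
  exact: xi_neq0.
have Nw' j : N (w' j).
  by apply: (N_sc (gamma j)); rewrite // -xv'; apply: NZ.
(* The second copy is removed from the generator. *)
have {}Nm : N (\sum_i p i + \sum_j v j).
  by move: Nm; rewrite addrA => /N_cancel; apply; apply: N_sum.
have Nv j : N (v j).
  have := NZ (weight_proj (alpha j) (beta j)) _ Nm.
  rewrite !scalerDr !scaler_sumr.
  rewrite big1 ?add0r => [|i _]; last first.
    rewrite (weight_projE _ _ _ _ (p_weight i)) //.
    case: ifP => [/andP[/eqP li /eqP bj]|//].
    by case/eqP: (beta_neq j); rewrite -bj li.
  rewrite (bigD1 j) //= (weight_projE _ _ _ _ (v_weight j)) // !eqxx /=.
  rewrite big1 ?addr0 // => j' /eqP j'j.
  rewrite (weight_projE _ _ _ _ (v_weight j')) //.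
  case: ifP => [/andP[/eqP ea /eqP eb]|//].
  by case: j'j; apply: alpha_beta_inj.
have Nw j : N (w j).
  by apply: (N_sc (gamma j)); rewrite // -xv; apply: NZ.
have {}Nm : N (\sum_i p i) by apply: N_cancel Nm _; apply: N_sum.
split=> // i.
have := NZ (weight_proj (lam i) (lam i ^+ 2)) _ Nm.
rewrite scaler_sumr (bigD1 i) //= (weight_projE _ _ _ _ (p_weight i)) // !eqxx /=.
rewrite big1 ?addr0 // => i' /eqP i'i.
rewrite (weight_projE _ _ _ _ (p_weight i')) //.
by case: ifP => [/andP[/eqP /lam_inj]|//].
Qed.

End CyclicGenerator.

(** A cyclic module whose dimension is the size of a spanning family of the
    algebra is free on its generator: the surjection from the coefficients of
    that family to the module is injective for reasons of dimension. The map [th] identifies the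
    module with a vector space over the base field, where dimensions are
    available. *)
Section DimensionCount.
Variables (k : fieldType) (A : pzRingType) (sc : {rmorphism k -> A}).
Variables (W : finType) (F : W -> A) (M : lmodType A) (m : M).
Variables (L : vectType k) (th : M -> L).
Hypothesis F_span : forall y, exists C : {ffun W -> k^o}, y = \sum_w sc (C w) * F w.
Hypothesis m_gen : forall u : M, exists y, u = y *: m.
Hypothesis thD : {morph th : u u' / u + u'}.
Hypothesis thZ : forall s u, th (sc s *: u) = s *: th u.
Hypothesis th_bij : bijective th.
Hypothesis dimL : dim L = #|W|.

Let coords (C : {ffun W -> k^o}) : L := \sum_w C w *: th (F w *: m).

Fact coords_linear : linear coords.
Proof.
move=> s C C'; rewrite /coords scaler_sumr -big_split /=; apply: eq_bigr => w _.
by rewrite !ffunE scalerDl scalerA.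
Qed.

Let th0 : th 0 = 0.
Proof. by apply: (addrI (th 0)); rewrite -thD !addr0. Qed.

Fact coordsE (C : {ffun W -> k^o}) : th ((\sum_w sc (C w) * F w) *: m) = coords C.
Proof.
rewrite scaler_suml (big_morph th thD th0); apply: eq_bigr => w _.
by rewrite -scalerA thZ.
Qed.

Lemma coords_inj : injective coords.
Proof.
pose f : {linear {ffun W -> k^o} -> L} :=
  HB.pack_for {linear {ffun W -> k^o} -> L} coords
    (GRing.isLinear.Build k {ffun W -> k^o} L *:%R coords coords_linear).
have f_surj : limg (linfun f) = fullv.
  apply/eqP; rewrite eqEsubv subvf /=; apply/subvP => y _.
  have [th' thK th'K] := th_bij.
  have [r mr] := m_gen (th' y); have [C rE] := F_span r.
  have -> : y = linfun f C by rewrite lfunE /= -coordsE -rE -mr th'K.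
  exact: memv_img (memvf C).
have kerf : lker (linfun f) == 0%VS.
  rewrite -dimv_eq0 -(eqn_add2r (\dim (limg (linfun f)))).
  have := limg_ker_dim (linfun f) fullv; rewrite capfv => ->.
  have dimW : dim {ffun W -> k^o} = #|W| by rewrite -[RHS]muln1.
  by rewrite f_surj !dimvf dimL dimW.
by move=> C C' CC'; apply: (lker0P kerf); rewrite !lfunE.
Qed.

Lemma cyclic_regular : iso A^o M.
Proof.
(* The action on [m] is injective because its values determine the
   coefficients. *)
have act_inj : injective (act_on (idfun : {linear A^o -> A^o}) m).
  move=> y y' yy'; have [C yE] := F_span y; have [C' y'E] := F_span y'.
  suff : C = C' by move=> CC'; rewrite yE y'E CC'.
  by apply: coords_inj; rewrite -!coordsE -yE -y'E; congr th.
exists (act_on idfun m); exists (fun u => projT1 (cid (m_gen u))) => [y|u].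
  by case: cid => r /= yr; apply/act_inj/esym.
by case: cid => r /= ->.
Qed.
End DimensionCount.

(** * The simple modules and their covers *)

Section Columns.
Variable k : fieldType.

Definition col2 (p q : k) : 'cV[k]_2 := \col_i (if i == 0 then p else q).

Lemma mx2_col2 p q r s u v :
  mx2 p q r s *m col2 u v = col2 (p * u + q * v) (r * u + s * v).
Proof.
apply/matrixP => i j; rewrite !mxE !big_ord_recl big_ord0 addr0 !mxE /=.
by case: i => [[|[|//]] ?].
Qed.

Lemma col2D p q r s : col2 p q + col2 r s = col2 (p + r) (q + s).
Proof. by apply/matrixP => i j; rewrite !mxE; case: ifP. Qed.

Lemma col2Z c p q : c *: col2 p q = col2 (c * p) (c * q).
Proof. by apply/matrixP => i j; rewrite !mxE; case: ifP. Qed.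

Lemma col2_0 : 0 = col2 0 0.
Proof. by apply/matrixP => i j; rewrite !mxE; case: ifP. Qed.

Lemma col2_eta (u : 'cV[k]_2) : u = col2 (u 0 0) (u 1 0).
Proof.
by apply/matrixP => i j; rewrite !mxE ord1; case: i => [[|[|//]] ?];
  congr (u _ _); apply/val_inj.
Qed.

Definition col4 (u : nat -> k) : 'cV[k]_4 := \col_i u i.

Lemma mx4_col4 f u : mx4 f *m col4 u = col4 (fun i =>
  f i 0%N * u 0%N + f i 1%N * u 1%N + f i 2%N * u 2%N + f i 3%N * u 3%N).
Proof.
by apply/matrixP => i j; rewrite !mxE !big_ord_recl big_ord0 addr0 !mxE !addrA.
Qed.

Lemma col4D u v : col4 u + col4 v = col4 (fun i => u i + v i).
Proof. by apply/matrixP => i j; rewrite !mxE. Qed.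

Lemma col4Z c u : c *: col4 u = col4 (fun i => c * u i).
Proof. by apply/matrixP => i j; rewrite !mxE. Qed.

Lemma eq_col4 u v : (forall i, (i < 4)%N -> u i = v i) -> col4 u = col4 v.
Proof. by move=> uv; apply/matrixP => i j; rewrite !mxE uv. Qed.

Lemma col4_eta (u : 'cV[k]_4) : u = col4 (fun i => u (inord i) 0).
Proof. by apply/matrixP => i j; rewrite !mxE ord1 inord_val. Qed.

End Columns.

Section Modules.
Variables (k : fieldType) (xi sqrt2 : k).
Hypothesis prim_xi : 4.-primitive_root xi.
Hypothesis sqrt2P : sqrt2 ^+ 2 = 2.
Let xi2 := prim4_sqr prim_xi.
Let two0 := two_neq0 prim_xi.
Let xi0 : xi != 0 := xi_neq0 xi2.

Local Notation E := (D_relations xi sqrt2).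
Local Notation sc := (scalar_of E).
Local Notation gen h := (gen_of E h).

Lemma sqrt2_neq0 : sqrt2 != 0.
Proof. by apply/eqP => s0; move/eqP: two0; rewrite -sqrt2P s0 expr0n. Qed.

Section VModule.
Variable ij : Lambda.
Local Notation V := (V prim_xi sqrt2P ij).
Definition alpha := xi ^+ (val ij).1.
Definition beta := xi ^+ (val ij).2.

Definition V_vec (p q : k) : V := col2 p q.

(** The coefficient of [x] from the first to the second basis vector. It
    vanishes exactly when [beta = alpha ^+ 2], that is outside [Lambda]. *)
Definition gamma := sqrt2 * xi * (alpha ^+ 3 - alpha * beta).

Lemma V_a p q : gen Ga *: V_vec p q = V_vec (alpha * p) (- xi * alpha * q).
Proof.
rewrite gen_of_scale [LHS]mx2_col2 !mul0r addr0 add0r exprD.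
by congr col2; rewrite -/alpha exprS xi2; ring.
Qed.

Lemma V_g p q : gen Gg *: V_vec p q = V_vec (beta * p) (- beta * q).
Proof.
rewrite gen_of_scale [LHS]mx2_col2 !mul0r addr0 add0r exprD.
by congr col2; rewrite -/beta xi2; ring.
Qed.

Lemma V_c p q : gen Gc *: V_vec p q = V_vec q 0.
Proof. by rewrite gen_of_scale [LHS]mx2_col2 !mul0r mul1r addr0 add0r. Qed.

Lemma V_x p : gen Gx *: V_vec p 0 = V_vec 0 (gamma * p).
Proof.
rewrite gen_of_scale [LHS]mx2_col2 !mul0r mulr0 addr0 addr0.
congr col2; rewrite /gamma /alpha /beta; congr (_ * _ * _).
by rewrite exprD mulnC exprM.
Qed.

Lemma V_sc s p q : sc s *: V_vec p q = V_vec (s * p) (s * q).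
Proof. by rewrite scalar_of_scale [LHS]col2Z. Qed.

Lemma V_add p q r s : V_vec p q + V_vec r s = V_vec (p + r) (q + s).
Proof. exact: col2D. Qed.

Lemma V_eta (u : V) : exists p q, u = V_vec p q.
Proof. by exists ((u : 'cV[k]_2) 0 0), ((u : 'cV[k]_2) 1 0); apply: col2_eta. Qed.

Lemma V_vec0 : V_vec 0 0 = 0.
Proof. exact/esym/col2_0. Qed.

Lemma alpha4 : alpha ^+ 4 = 1. Proof. exact: xi4. Qed.
Lemma beta4 : beta ^+ 4 = 1. Proof. exact: xi4. Qed.

(** The defining condition of [Lambda], seen on eigenvalues. *)
Lemma beta_neq : beta != alpha ^+ 2.
Proof.
apply/eqP; rewrite /beta /alpha -exprM => /eqP.
rewrite (eq_prim_root_expr prim_xi) => /eqP e; have /eqP[] := valP ij.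
apply/val_inj; rewrite mulr2n /= -[RHS](@modn_small _ 4) ?ltn_ord // e muln2.
by rewrite addnn.
Qed.

Lemma gamma_neq0 : gamma != 0.
Proof.
have al0 : alpha != 0 by rewrite expf_neq0.
rewrite /gamma !mulf_neq0 ?sqrt2_neq0 // exprS -mulrBr mulf_neq0 //.
by rewrite subr_eq0 eq_sym beta_neq.
Qed.

(** [c] maps the second basis vector to the first one and kills the first one,
    and [x] maps the first one to a nonzero multiple of the second one: any
    nonzero vector reaches the first basis vector, and then everything. *)
Lemma V_simple : simple V.
Proof.
split.
  exists (V_vec 1 0) => /(congr1 (fun u : V => (u : 'cV[k]_2) 0 0)) /eqP.
  by rewrite !mxE /= oner_eq0.
move=> U sU; have UZ := submod_scale sU; have UD := submod_add sU.
have U_full p : p != 0 -> V_vec p 0 \in U -> forall u, u \in U.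
  move=> p0 Up u; have [q [r ->]] := V_eta u.
  have Uq : V_vec q 0 \in U.
    by have := UZ (sc (q / p)) _ Up; rewrite V_sc mulr0 divfK.
  have Ur : V_vec 0 r \in U.
    have := UZ (gen Gx) _ Up; rewrite V_x => /(UZ (sc (r / (gamma * p)))).
    by rewrite V_sc mulr0 divfK // mulf_neq0 ?gamma_neq0.
  by have := UD _ _ Uq Ur; rewrite V_add addr0 add0r.
have [[u /asboolP/andP[uU u0]]|nU] := pselect (exists u, `[< (u \in U) && (u != 0) >]).
  right; have [p [q uE]] := V_eta u.
  have [q0|q0] := eqVneq q 0; last first.
    by apply: (U_full q q0); rewrite -(V_c p q) -uE; apply: UZ.
  apply: (U_full p); last by rewrite -q0 -uE.
  by apply: contra_neq u0 => p0; rewrite uE p0 q0 V_vec0.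
left=> v vU; apply/eqP; apply: contrapT => /negP v0; apply: nU; exists v.
by apply/asboolP/andP; split.
Qed.

End VModule.

Lemma alpha_beta_inj (ij ij' : Lambda) : alpha ij = alpha ij' -> beta ij = beta ij' -> ij = ij'.
Proof.
have xi_inj (i i' : 'Z_4) : xi ^+ i = xi ^+ i' -> i = i'.
  move/eqP; rewrite (eq_prim_root_expr prim_xi) !modn_small ?ltn_ord //.
  by move/eqP/val_inj.
move=> /xi_inj e1 /xi_inj e2; apply/val_inj.
by rewrite [LHS]surjective_pairing e1 e2 -surjective_pairing.
Qed.

Section CharModule.
Variable l : 'I_4.

Lemma kchi_simple : simple (kchi sqrt2 prim_xi l).
Proof.
have ent (u : kchi sqrt2 prim_xi l) : u = ((u : 'cV[k]_1) 0 0)%:M.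
  by rewrite -mx11_scalar.
split.
  exists (1%:M : 'cV[k]_1) => /(congr1 (fun u : 'cV[k]_1 => u 0 0)) /eqP.
  by rewrite !mxE /= oner_eq0.
move=> U sU; have UZ := submod_scale sU.
have [[u /asboolP/andP[uU u0]]|nU] := pselect (exists u, `[< (u \in U) && (u != 0) >]).
  right=> v; have -> : v = sc ((v : 'cV[k]_1) 0 0 / (u : 'cV[k]_1) 0 0) *: u.
    rewrite scalar_of_scale [in RHS](ent u) [LHS]ent scale_scalar_mx !mxE mulr1n divfK //.
    by apply: contra_neq u0 => u00; rewrite (ent u) u00 raddf0.
  exact: UZ.
left=> v vU; apply/eqP; apply: contrapT => /negP v0; apply: nU; exists v.
by apply/asboolP/andP; split.
Qed.

Local Notation P1 := (P1 prim_xi sqrt2P l).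
Definition lam := xi ^+ l.

Definition P1_vec (u : nat -> k) : P1 := col4 u.

(** Tensoring with a character rescales the action of each generator. *)
Definition P1_coef (h : Defs.gen) : k :=
  match h with Ga | Gb => lam | Gc | Gd => lam ^+ 3 | Gx => 1 | Gg => lam ^+ 2 end.

Lemma P1_rep_gen (h : Defs.gen) :
  tens xi2 (P_rep prim_xi sqrt2P) (chi_rep sqrt2 prim_xi l) h =
  P1_coef h *: mx4 (fun i j => nth 0 (nth [::] (P_rows xi sqrt2 h) i) j).
Proof.
have tensZ (A : 'M[k]_4) c : A *t (c%:M : 'M_1) = c *: A.
  rewrite tens_mx_scalar; set e := (_, _); case: e => e1 e2.
  by rewrite (eq_irrelevance e1 erefl) (eq_irrelevance e2 erefl) castmx_id.
rewrite /= /tens_gen -P_genE.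
case: h => /=; rewrite ?tensmx0 ?addr0 ?add0r ?tensZ //.
- by rewrite xiV.
- by rewrite xiV.
- by rewrite (signxi prim_xi).
Qed.

Lemma lam4 : lam ^+ 4 = 1. Proof. exact: xi4. Qed.

Lemma P1_sc s u : sc s *: P1_vec u = P1_vec (fun i => s * u i).
Proof. by rewrite scalar_of_scale [LHS]col4Z. Qed.

Lemma P1_add u v : P1_vec u + P1_vec v = P1_vec (fun i => u i + v i).
Proof. exact: col4D. Qed.

Lemma P1_eta (u : P1) : exists u', u = P1_vec u'.
Proof. by exists (fun i => (u : 'cV[k]_4) (inord i) 0); apply: col4_eta. Qed.

Lemma P1_gen (h : Defs.gen) u : gen h *: P1_vec u = P1_vec (fun i =>
  let r j := nth 0 (nth [::] (P_rows xi sqrt2 h) i) j in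
  P1_coef h * (r 0%N * u 0%N + r 1%N * u 1%N + r 2%N * u 2%N + r 3%N * u 3%N)).
Proof.
rewrite gen_of_scale P1_rep_gen.
rewrite -[LHS]scalemxAl [X in _ *: X]mx4_col4.
exact: col4Z.
Qed.

Lemma P1_eq u v : u 0%N = v 0%N -> u 1%N = v 1%N -> u 2%N = v 2%N -> u 3%N = v 3%N ->
  P1_vec u = P1_vec v.
Proof. by move=> *; apply: eq_col4 => -[|[|[|[|]]]]. Qed.

(** The vector [p *: p_1 + q *: p_2 + r *: p_3 + s *: p_4]. *)
Definition P1_quad (p q r s : k) : P1 := P1_vec (nth 0 [:: p; q; r; s]).

Lemma P1_a p q r s : gen Ga *: P1_quad p q r s = P1_quad (lam * p) (- xi * lam * q) (xi * lam * r) (lam * s).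
Proof. by rewrite P1_gen; apply: P1_eq => /=; ring. Qed.

Lemma P1_g p q r s : gen Gg *: P1_quad p q r s = P1_quad (lam ^+ 2 * p) (- lam ^+ 2 * q) (- lam ^+ 2 * r) (lam ^+ 2 * s).
Proof. by rewrite P1_gen; apply: P1_eq => /=; ring. Qed.

Lemma P1_b p q r s : gen Gb *: P1_quad p q r s = P1_quad 0 0 (lam * p) (xi * lam * q).
Proof. by rewrite P1_gen; apply: P1_eq => /=; ring. Qed.

Lemma P1_c p q r s : gen Gc *: P1_quad p q r s = P1_quad 0 0 (- lam ^+ 3 * p) (xi * lam ^+ 3 * q).
Proof. by rewrite P1_gen; apply: P1_eq => /=; ring. Qed.

Lemma P1_d p q r s : gen Gd *: P1_quad p q r s =
  P1_quad (lam ^+ 3 * p) (xi * lam ^+ 3 * q) (- xi * lam ^+ 3 * r) (lam ^+ 3 * s).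
Proof. by rewrite P1_gen; apply: P1_eq => /=; ring. Qed.

Lemma P1_x p q r s : gen Gx *: P1_quad p q r s = P1_quad 0 p (sqrt2 * p) (r - sqrt2 * q).
Proof. by rewrite P1_gen; apply: P1_eq => /=; ring. Qed.

Lemma P1_quadZ t p q r s : sc t *: P1_quad p q r s = P1_quad (t * p) (t * q) (t * r) (t * s).
Proof. by rewrite P1_sc; apply: P1_eq. Qed.

Lemma P1_quadD p q r s p' q' r' s' :
  P1_quad p q r s + P1_quad p' q' r' s' = P1_quad (p + p') (q + q') (r + r') (s + s').
Proof. by rewrite P1_add; apply: P1_eq. Qed.

Lemma P1_quad_eta (u : P1) : exists p q r s, u = P1_quad p q r s.
Proof.
have [u' ->] := P1_eta u; exists (u' 0%N), (u' 1%N), (u' 2%N), (u' 3%N).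
exact: P1_eq.
Qed.

Definition P1_top (u : P1) : k := (u : 'cV[k]_4) 0 0.

Lemma P1_topE p q r s : P1_top (P1_quad p q r s) = p.
Proof. by rewrite /P1_top mxE. Qed.

(** The action of [b] and [c] on [(p, q, r, s)] only sees [p] and [q], with
    relative signs that allow one to extract the third basis vector as soon as
    [p] is nonzero; [x] then produces the fourth and the second one. *)
Lemma P1_generate (N : P1 -> Prop) p q r s :
  (forall u u', N u -> N u' -> N (u + u')) -> (forall y u, N u -> N (y *: u)) ->
  p != 0 -> N (P1_quad p q r s) -> forall u, N u.
Proof.
move=> ND NZ p0 Nu.
have lam0 : lam != 0 by rewrite expf_neq0.
have Neq u v : N u -> u = v -> N v by move=> ? <-.
have N2 t : N (P1_quad 0 0 t 0).
  (* After normalization, the images under b and c have the same third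
     coordinate and opposite fourth coordinates. *)
  have := NZ (sc (lam ^+ 3)) _ (NZ (gen Gb) _ Nu); rewrite P1_b P1_quadZ => Nb.
  have := NZ (sc (- lam)) _ (NZ (gen Gc) _ Nu); rewrite P1_c P1_quadZ => Nc.
  have := NZ (sc (t / (2 * p))) _ (ND _ _ Nb Nc); rewrite P1_quadD P1_quadZ.
  move=> /Neq; apply; apply: P1_eq => /=; field: lam4; rewrite p0 //.
have N3 t : N (P1_quad 0 0 0 t).
  have := NZ (gen Gx) _ (N2 t); rewrite P1_x.
  by move=> /Neq; apply; apply: P1_eq => /=; ring.
have {}Nu : N (P1_quad p q 0 0).
  have := ND _ _ Nu (ND _ _ (N2 (- r)) (N3 (- s))); rewrite !P1_quadD.
  by move=> /Neq; apply; apply: P1_eq => /=; ring.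
have N1 t : N (P1_quad 0 t 0 0).
  have := NZ (gen Gx) _ Nu; rewrite P1_x => Nx.
  have := ND _ _ Nx (ND _ _ (N2 (- (sqrt2 * p))) (N3 (sqrt2 * q))).
  rewrite !P1_quadD => /(NZ (sc (t / p))); rewrite P1_quadZ.
  by move=> /Neq; apply; apply: P1_eq => /=; field.
move=> u; have [p' [q' [r' [s' ->]]]] := P1_quad_eta u.
have := ND _ _ (NZ (sc (p' / p)) _ Nu) (ND _ _ (N1 (q' - p' / p * q)) (ND _ _ (N2 r') (N3 s'))).
rewrite P1_quadZ !P1_quadD.
by move=> /Neq; apply; apply: P1_eq => /=; field.
Qed.

(** The radical is the hyperplane spanned by the last three basis vectors. *)
Lemma P1_local : local P1.
Proof.
apply: (@local_of_radical _ _ (fun u => P1_top u = 0) (P1_quad 1 0 0 0)).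
- by rewrite P1_topE; apply/eqP; rewrite oner_eq0.
- by move=> u v u0 v0; rewrite -[RHS]addr0 -{1}u0 -v0 /P1_top mxE.
- move=> U sU u; have [p [q [r [s ->]]]] := P1_quad_eta u => Uu /eqP.
  rewrite P1_topE => p0; apply: (P1_generate _ _ p0 Uu).
    exact: submod_add.
  exact: submod_scale.
Qed.

Definition kchi_coef (h : Defs.gen) : k :=
  match h with Ga => lam | Gd => lam ^+ 3 | Gg => lam ^+ 2 | _ => 0 end.

Lemma kchi_gen h t : gen h *: (t%:M : kchi sqrt2 prim_xi l) = (kchi_coef h * t)%:M.
Proof.
rewrite [LHS]gen_of_scale scalar_mxM; congr (_ *m _).
by case: h => /=; rewrite ?raddf0 ?xiV ?(signxi prim_xi).
Qed.

Definition P1_to_kchi (u : P1) : kchi sqrt2 prim_xi l := (P1_top u)%:M.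

Fact P1_to_kchi_linear : linear P1_to_kchi.
Proof.
apply: presented_linear => [u v|t u|h u].
- by rewrite /P1_to_kchi /P1_top mxE raddfD.
- have [p [q [r [s ->]]]] := P1_quad_eta u.
  by rewrite P1_quadZ /P1_to_kchi !P1_topE scalar_of_scale scale_scalar_mx.
have [p [q [r [s ->]]]] := P1_quad_eta u; rewrite /P1_to_kchi P1_topE kchi_gen.
congr _%:M; case: h => /=.
- by rewrite P1_a P1_topE.
- by rewrite P1_b P1_topE mul0r.
- by rewrite P1_c P1_topE mul0r.
- by rewrite P1_d P1_topE.
- by rewrite P1_x P1_topE mul0r.
- by rewrite P1_g P1_topE.
Qed.
HB.instance Definition _ := GRing.isLinear.Build (D xi sqrt2) P1
  (kchi sqrt2 prim_xi l) *:%R P1_to_kchi P1_to_kchi_linear.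

End CharModule.

Lemma lam_inj : injective lam.
Proof.
move=> l l' /eqP; rewrite (eq_prim_root_expr prim_xi) !modn_small ?ltn_ord //.
by move/eqP/val_inj.
Qed.

End Modules.

(** * The regular module *)

Lemma card_Lambda : #|{: Lambda}| = 12.
Proof.
rewrite card_sig -sum1_card big_mkcond /=.
rewrite -(pair_bigA _ (fun i j : 'Z_4 => if i *+ 2 != j then 1 else 0)%N) /=.
by rewrite !big_ord_recl !big_ord0.
Qed.

Section Assembly.
Variables (k : fieldType) (xi sqrt2 : k).
Hypothesis prim_xi : 4.-primitive_root xi.
Hypothesis sqrt2P : sqrt2 ^+ 2 = 2.
Let xi2 := prim4_sqr prim_xi.
Let two0 := two_neq0 prim_xi.

Local Notation E := (D_relations xi sqrt2).
Local Notation sc := (scalar_of E).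
Local Notation gen h := (gen_of E h).
Local Notation D := (D xi sqrt2).
Local Notation P1 := (P1 prim_xi sqrt2P).
Local Notation V := (V prim_xi sqrt2P).
Local Notation P1_quad l := (@P1_quad _ _ _ prim_xi sqrt2P l).
Local Notation V_vec ij := (@V_vec _ _ _ prim_xi sqrt2P ij).

(** The eigenvalues of [a] and [g] on the basis vectors meet the conditions of
    [cyclic_generator], and the first basis vector of [P1 l] generates it. The
    inclusions [iP], [iV] and [iV'] are arbitrary linear maps here, which keeps
    the shape of the direct sum out of the computation. *)
Lemma basis_generate (M : lmodType D) (iP : forall l, {linear P1 l -> M})
    (iV iV' : forall ij, {linear V ij -> M}) (N : M -> Prop) :
  (forall u u', N u -> N u' -> N (u + u')) -> (forall y u, N u -> N (y *: u)) ->
  N (\sum_l iP l (P1_quad l 1 0 0 0) +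
      (\sum_ij iV ij (V_vec ij 1 0) + \sum_ij iV' ij (V_vec ij 0 1))) ->
  [/\ forall l u, N (iP l u), forall ij u, N (iV ij u) & forall ij u, N (iV' ij u)].
Proof.
move=> ND NZ Nm.
have VZ (i : forall ij, {linear V ij -> M}) ij p q :
    N (i ij (V_vec ij 1 0)) -> N (i ij (V_vec ij 0 1)) -> N (i ij (V_vec ij p q)).
  move=> /(NZ (sc p)); rewrite -linearZ /= V_sc mulr0 mulr1 => Np.
  move=> /(NZ (sc q)); rewrite -linearZ /= V_sc mulr0 mulr1 => Nq.
  by have := ND _ _ Np Nq; rewrite -linearD V_add addr0 add0r.
have pw l : weight_vector sc (gen Ga) (gen Gg) (lam xi l) (lam xi l ^+ 2)
    (iP l (P1_quad l 1 0 0 0)).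
  by split; rewrite -!linearZ /= P1_quadZ ?P1_a ?P1_g; congr (iP l _); apply: P1_eq => /=; rewrite ?mulr0.
have vw ij : weight_vector sc (gen Ga) (gen Gg) (alpha xi ij) (beta xi ij)
    (iV ij (V_vec ij 1 0)).
  by split; rewrite -!linearZ /= V_sc ?V_a ?V_g; congr (iV ij _); congr (V_vec ij _ _); rewrite !mulr0.
have ww ij : weight_vector sc (gen Ga) (gen Gg) (- xi * alpha xi ij) (- beta xi ij)
    (iV' ij (V_vec ij 0 1)).
  by split; rewrite -!linearZ /= V_sc ?V_a ?V_g; congr (iV' ij _); congr (V_vec ij _ _); rewrite !mulr0.
have cv ij : gen Gc *: iV ij (V_vec ij 1 0) = 0.
  by rewrite -linearZ /= V_c V_vec0 linear0.
have cw ij : gen Gc *: iV' ij (V_vec ij 0 1) = iV' ij (V_vec ij 1 0).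
  by rewrite -linearZ /= V_c.
have xv (i : forall ij, {linear V ij -> M}) ij :
    gen Gx *: i ij (V_vec ij 1 0) = sc (gamma xi sqrt2 ij) *: i ij (V_vec ij 0 1).
  by rewrite -!linearZ /= V_sc V_x mulr0.
have [Np Nv Nw Nv' Nw'] := cyclic_generator two0 xi2 (@scalarC _ _ E) pw
  (lam4 prim_xi) (lam_inj prim_xi) vw ww (alpha4 prim_xi) (beta4 prim_xi)
  (beta_neq prim_xi) (alpha_beta_inj prim_xi) (gamma_neq0 prim_xi sqrt2P) cv cw
  (xv iV) (xv iV') ND NZ Nm.
split=> [l u|ij u|ij u].
- apply: (P1_generate (N := fun u => N (iP l u)) _ _ (oner_neq0 k) (Np l)).
    by move=> u1 u2 N1 N2; rewrite linearD; apply: ND.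
  by move=> y u1 N1; rewrite linearZ; apply: NZ.
- by have [p [q ->]] := V_eta u; apply: VZ.
- by have [p [q ->]] := V_eta u; apply: VZ.
Qed.

Local Notation M := (sum_of_pairs P1 V V).

Definition D_generator : M :=
  (\sum_l sum_inj P1 V V l (P1_quad l 1 0 0 0) +
   (\sum_ij sum_injl P1 V V ij (V_vec ij 1 0) +
    \sum_ij sum_injr P1 V V ij (V_vec ij 0 1))).

Lemma D_generatorP (m : M) : exists y : D, m = y *: D_generator.
Proof.
pose N (u : M) := exists y : D, u = y *: D_generator.
have ND u u' : N u -> N u' -> N (u + u').
  by move=> [y ->] [z ->]; exists (y + z); rewrite scalerDl.
have NZ z u : N u -> N (z *: u).
  by move=> [y ->]; exists (z * y); rewrite scalerA.
have N_gen : N D_generator by exists 1; rewrite scale1r.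
have N0 : N 0 by exists 0; rewrite scale0r.
have [Np Nv Nv'] := basis_generate ND NZ N_gen.
have N_sum (K : finType) (F : K -> M) : (forall i, N (F i)) -> N (\sum_i F i).
  by move=> NF; apply: (big_ind N).
rewrite -/(N m) [m]sum_of_pairs_decomp.
by apply: (ND); [|apply: (ND)]; apply: N_sum => i.
Qed.

(** A module over D has no structure over [k] of its own: dimensions are taken
    in this copy of the direct sum. *)
Definition coord_space : vectType k :=
  ({ffun 'I_4 -> 'cV[k]_(4 * 1)} * {ffun Lambda -> ('cV[k]_2 * 'cV[k]_2)%type})%type.

Definition coord (m : M) : coord_space :=
  ([ffun l => m.1 l : 'cV[k]_(4 * 1)],
   [ffun ij => ((m.2 ij).1 : 'cV[k]_2, (m.2 ij).2 : 'cV[k]_2)]).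

Lemma coordD : {morph coord : m m' / m + m'}.
Proof.
by move=> m m'; congr (_, _); apply/ffunP => i; rewrite !ffunE.
Qed.

Lemma coordZ s (m : M) : coord (sc s *: m) = s *: coord m.
Proof.
by congr (_, _); apply/ffunP => i; rewrite !ffunE /= ?scalar_of_scale //; congr (_, _);
  apply: scalar_of_scale.
Qed.

Lemma coord_bij : bijective coord.
Proof.
exists (fun c : coord_space => ([ffun l => c.1 l : P1 l] : dsum P1,
  [ffun ij => ((c.2 ij).1 : V ij, (c.2 ij).2 : V ij)] : dsum (fun ij => (V ij * V ij)%type)) : M).
- move=> [u v]; congr (_, _); apply/ffunP => i; rewrite !ffunE //.
  by rewrite [RHS]surjective_pairing.
- move=> [u v]; congr (_, _); apply/ffunP => i; rewrite !ffunE //.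
  by rewrite [RHS]surjective_pairing.
Qed.

Lemma dim_coord_space : dim coord_space = 64.
Proof.
rewrite -[LHS]/(#|'I_4| * (4 * 1 * 1) + #|{: Lambda}| * (2 * 1 + 2 * 1))%N.
by rewrite card_ord card_Lambda.
Qed.

(** Both sides have dimension 64: the monomials bound the left one from above,
    and the right one is a quotient of it since it is cyclic. *)
Lemma D_regular_iso : iso D^o M.
Proof.
apply: (@cyclic_regular k D sc exponents _ M D_generator coord_space coord
  _ D_generatorP coordD coordZ coord_bij).
  apply: (monomials_span xi2 (@scalarC _ _ E) (D_ring_relationsP xi sqrt2)).
  exact: D_generating.
by rewrite dim_coord_space !card_prod !card_ord.
Qed.

(** A simple module is a quotient of the regular one, so that one of the
    summands has a nonzero map to it. *)
Lemma D_simple_surjected (S : lmodType D) : simple S ->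
  (exists l, exists f : {linear P1 l -> S}, exists p, f p <> 0) \/
  (exists ij, exists f : {linear V ij -> S}, exists p, f p <> 0).
Proof.
move=> [S0 _]; have [h [m /sum_of_pairs_nonzero_map[]]] := iso_regular_nonzero_map D_regular_iso S0.
- by move=> [l [q hq]]; left; exists l; eexists; exists q; apply: hq.
- by move=> [ij [q hq]]; right; exists ij; eexists; exists q; apply: hq.
- by move=> [ij [q hq]]; right; exists ij; eexists; exists q; apply: hq.
Qed.

Lemma P1_projective l : projective (P1 l).
Proof. exact: retract_iso_regular_projective D_regular_iso (retract_sum_inj _ _ _ l). Qed.

Lemma V_projective ij : projective (V ij).
Proof. exact: retract_iso_regular_projective D_regular_iso (retract_sum_injl _ _ _ ij). Qed.

End Assembly.

Theorem theorem2p14 (k : closedFieldType) (char0 : [pchar k] =i pred0)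
    (xi sqrt2 : k) (prim_xi : 4.-primitive_root xi) (sqrt2P : sqrt2 ^+ 2 = 2) :
  [/\ forall l : 'I_4,
         simple (kchi sqrt2 prim_xi l) /\
         projective_cover (P1 prim_xi sqrt2P l) (kchi sqrt2 prim_xi l),
      forall ij : Lambda,
         simple (V prim_xi sqrt2P ij) /\
         projective_cover (V prim_xi sqrt2P ij) (V prim_xi sqrt2P ij),
      forall S : lmodType (D xi sqrt2), simple S ->
         (exists l : 'I_4, projective_cover (P1 prim_xi sqrt2P l) S) \/
         (exists ij : Lambda, projective_cover (V prim_xi sqrt2P ij) S)
    & iso (D xi sqrt2)^o
          (dsum (fun l : 'I_4 => P1 prim_xi sqrt2P l) *
           dsum (fun ij : Lambda =>
                   (V prim_xi sqrt2P ij * V prim_xi sqrt2P ij)%type))%type].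
Proof.
split=> [l|ij|S simS|]; last exact: D_regular_iso.
- split; first exact: kchi_simple.
  apply: (local_projective_cover (f := @P1_to_kchi _ _ _ prim_xi sqrt2P l)).
  + exact: P1_projective.
  + exact: P1_local.
  + exact: kchi_simple.
  exists (P1_quad prim_xi sqrt2P l 1 0 0 0) => /(congr1 (fun u : 'cV[k]_1 => u 0 0)) /eqP.
  by rewrite /= /P1_to_kchi P1_topE !mxE /= oner_eq0.
- have simV := V_simple prim_xi sqrt2P ij; split=> //.
  apply: (local_projective_cover (f := idfun)) => //.
  + exact: V_projective.
  + exact: simple_local.
  by case: simV.
have [[l [f f0]]|[ij [f f0]]] := D_simple_surjected prim_xi sqrt2P simS.
  left; exists l; apply: local_projective_cover simS f0.
    exact: P1_projective.
  exact: P1_local.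
right; exists ij; apply: local_projective_cover simS f0.
  exact: V_projective.
exact/simple_local/V_simple.
Qed.
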